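(* Let $p$ be a prime and let $(R,\mathfrak m)$ be a reduced Noetherian local ring of characteristic $p>0$ which is a residue class ring of a Gorenstein local ring. If $R$ is $F$-coherent, then every system of parameters of $R$ is a regular sequence on the perfect closure $R^{\infty}$.
   Context: All rings are commutative with unit. A ring is coherent if every finitely generated ideal is finitely presented. For a ring $R$ of characteristic $p>0$, the perfect closure $R^{\infty}$ is obtained by adjoining to $R_{\mathrm{red}}$ (the quotient of $R$ by its nilradical) all $p^e$-th roots ($e\ge 1$) of all elements of $R_{\mathrm{red}}$; equivalently, $R^\infty$ is the direct limit of $R\xrightarrow{F}R\xrightarrow{F}R\to\cdots$, where $F$ is the Frobenius map $a \mapsto a^p$. A Noetherian ring $R$ of characteristic $p>0$ is called $F$-coherent if $R^{\infty}$ is a coherent ring. *)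

(* Defs.v *)
From HB Require Import structures.
From mathcomp Require Import all_boot all_order all_algebra generic_quotient.
From mathcomp Require Import zify.
From mathcomp Require Import boolp classical_sets.

Set Implicit Arguments.
Unset Strict Implicit.
Unset Printing Implicit Defensive.

Import GRing.Theory.
Local Open Scope ring_scope.
Local Open Scope quotient_scope.
Local Open Scope classical_set_scope.

Section Modules.
Variables (A : comNzRingType) (V : lmodType A).
Implicit Type N : set V.

Definition is_submodule N : Prop :=
  [/\ N 0, forall u v, N u -> N v -> N (u + v) & forall a u, N u -> N (a *: u)].

Definition finitely_generated N : Prop :=
  exists n (phi : {linear 'rV[A]_n -> V}), range phi = N.

(* There is an exact sequence A^m -> A^n -> N -> 0. *)
Definition finitely_presented N : Prop :=
  exists m n (psi : {linear 'rV[A]_m -> 'rV[A]_n}) (phi : {linear 'rV[A]_n -> V}),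
    range psi = phi @^-1` [set 0] /\ range phi = N.

(* (x_1, ..., x_k) V for the sequence xs = (x_1, ..., x_k) *)
Definition seq_smul (xs : seq A) : set V :=
  [set v | exists c : 'I_(size xs) -> V, v = \sum_(i < size xs) xs`_i *: c i].

(* x_(i+1) is a nonzerodivisor on V / (x_1, ..., x_i) V, for all i,
   and V / (x_1, ..., x_k) V is nonzero. *)
Definition regular_sequence (xs : seq A) : Prop :=
  (forall i, (i < size xs)%N -> forall v : V,
     seq_smul (take i xs) (xs`_i *: v) -> seq_smul (take i xs) v) /\
  seq_smul xs <> setT.

End Modules.

Arguments regular_sequence {A} V xs.

Section InjectiveDimension.
Variable A : comNzRingType.

Definition injective_module (E : lmodType A) : Prop :=
  forall (M N : lmodType A) (i : {linear M -> N}) (f : {linear M -> E}),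
    injective i -> exists g : {linear N -> E}, forall x, g (i x) = f x.

(* There is an exact sequence 0 -> M -> I 0 -> I 1 -> ... -> I n -> 0
   of modules, with each I k injective. *)
Definition finite_injective_dimension (M : lmodType A) : Prop :=
  exists (n : nat) (I : nat -> lmodType A)
         (eps : {linear M -> I 0%N}) (d : forall k, {linear I k -> I k.+1}),
    [/\ forall k, injective_module (I k),
        forall k, (n < k)%N -> forall x : I k, x = 0,
        injective eps,
        range eps = d 0%N @^-1` [set 0] &
        forall k, range (d k) = d k.+1 @^-1` [set 0]].

End InjectiveDimension.

Section CommutativeRings.
Variable A : comNzRingType.
Implicit Types I P Q : set A.

Definition is_ideal I : Prop := is_submodule (I : set A^o).

Definition is_proper_ideal I : Prop := is_ideal I /\ ~ I 1.

Definition is_prime_ideal P : Prop :=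
  is_proper_ideal P /\ forall x y, P (x * y) -> P x \/ P y.

Definition is_maximal_ideal P : Prop :=
  is_proper_ideal P /\ forall I, is_proper_ideal I -> P `<=` I -> I = P.

Definition radical I : set A := [set x | exists n, I (x ^+ n)].

Definition is_primary_ideal Q : Prop :=
  is_proper_ideal Q /\
  forall x y, Q (x * y) -> Q x \/ exists n, Q (y ^+ n).

Definition noetherian : Prop :=
  forall I, is_ideal I -> finitely_generated (I : set A^o).

Definition is_local_ring (m : set A) : Prop :=
  is_maximal_ideal m /\ forall P, is_maximal_ideal P -> P = m.

Definition reduced : Prop := forall (x : A) n, x ^+ n = 0 -> x = 0.

Definition coherent : Prop :=
  forall I, is_ideal I -> finitely_generated (I : set A^o) ->
    finitely_presented (I : set A^o).

(* There is a chain P 0 < P 1 < ... < P n of prime ideals. *)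
Definition has_prime_chain (n : nat) : Prop :=
  exists P : nat -> set A,
    (forall i, (i <= n)%N -> is_prime_ideal (P i)) /\
    (forall i, (i < n)%N -> P i `<` P i.+1).

Definition krull_dimension (d : nat) : Prop :=
  has_prime_chain d /\ forall n, has_prime_chain n -> (n <= d)%N.

Definition ideal_gen (xs : seq A) : set A := @seq_smul A A^o xs.

(* xs has dim A elements and generates an m-primary ideal. *)
Definition system_of_parameters (m : set A) (xs : seq A) : Prop :=
  [/\ krull_dimension (size xs),
      is_primary_ideal (ideal_gen xs) & radical (ideal_gen xs) = m].

Definition gorenstein_local : Prop :=
  [/\ exists m : set A, is_local_ring m, noetherian
    & finite_injective_dimension A^o].

End CommutativeRings.

Definition residue_ring_of_gorenstein_local (R : comNzRingType) : Prop :=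
  exists (S : comNzRingType) (f : {rmorphism S -> R}),
    gorenstein_local S /\ range f = setT.

(* The perfect closure, as the direct limit of R -F-> R -F-> R -F-> ...:
   the class of (m, a) is the image of the element a of the m-th copy of R,
   that is, the p^m-th root of a.  Two pairs (m, a) and (n, b) are identified
   when F^(n+k) a = F^(m+k) b for some k.  *)
Section PerfectClosure.
Variables (R : comNzRingType) (p : nat).
Implicit Types (a b : R) (u v w : nat * R).

Definition pc_rel u v : bool :=
  `[< exists k, u.2 ^+ (p ^ (v.1 + k)) = v.2 ^+ (p ^ (u.1 + k)) >].

Let frA m n a : (a ^+ (p ^ m)) ^+ (p ^ n) = a ^+ (p ^ (m + n)).
Proof. by rewrite -exprM -expnD. Qed.

Lemma pc_rel_equiv : equiv_class_of pc_rel.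
Proof.
split=> [u|u v|v u w].
- by apply/asboolP; exists 0%N.
- by apply/idP/idP => /asboolP[k e]; apply/asboolP; exists k.
move=> /asboolP[k uv] /asboolP[l vw]; apply/asboolP; exists (v.1 + k + l)%N.
have -> : (w.1 + (v.1 + k + l) = v.1 + k + (w.1 + l))%N by lia.
rewrite -frA uv frA.
have -> : (u.1 + k + (w.1 + l) = w.1 + l + (u.1 + k))%N by lia.
by rewrite -frA vw frA; congr (_ ^+ (p ^ _)); lia.
Qed.

Canonical pc_equiv := EquivRelPack pc_rel_equiv.

Variable chRp : p \in [pchar R].

Let frD n a b : (a + b) ^+ (p ^ n) = a ^+ (p ^ n) + b ^+ (p ^ n).
Proof. by rewrite exprDn_pchar // pnatX pnatE ?(pcharf_prime chRp) ?chRp. Qed.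

Let frN n a : (- a) ^+ (p ^ n) = - (a ^+ (p ^ n)).
Proof. by rewrite exprNn_pchar // pnatX pnatE ?(pcharf_prime chRp) ?chRp. Qed.

Let fr0 n : 0 ^+ (p ^ n) = 0 :> R.
Proof. by rewrite expr0n expn_eq0 eqn0Ngt prime_gt0 ?(pcharf_prime chRp). Qed.

(* The argument chRp is recorded in the type so that the ring structure below
   can be inferred from it. *)
Definition perfect_closure (_ : p \in [pchar R]) : Type := {eq_quot pc_equiv}.
Local Notation PC := (perfect_closure chRp).

HB.instance Definition _ := Choice.on PC.

Definition pc_root m a : PC := \pi_{eq_quot pc_equiv} (m, a).

Lemma pc_rootP m a n b :
  pc_root m a = pc_root n b <->
  exists k, a ^+ (p ^ (n + k)) = b ^+ (p ^ (m + k)).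
Proof.
split=> [/eqquotP /asboolP //|h]; apply/eqquotP; exact/asboolP.
Qed.

Lemma pc_rootW (x : PC) : exists m a, x = pc_root m a.
Proof. by elim/quotW: x => -[m a]; exists m, a. Qed.

Let up k m a : pc_root m a = pc_root (m + k) (a ^+ (p ^ k)).
Proof. by apply/pc_rootP; exists 0%N; rewrite frA; congr (_ ^+ (p ^ _)); lia. Qed.

Definition pc_opp (x : PC) : PC :=
  let u := repr (x : {eq_quot pc_equiv}) in pc_root u.1 (- u.2).
Definition pc_add (x y : PC) : PC :=
  let u := repr (x : {eq_quot pc_equiv}) in
  let v := repr (y : {eq_quot pc_equiv}) in
  pc_root (u.1 + v.1) (u.2 ^+ (p ^ v.1) + v.2 ^+ (p ^ u.1)).
Definition pc_mul (x y : PC) : PC :=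
  let u := repr (x : {eq_quot pc_equiv}) in
  let v := repr (y : {eq_quot pc_equiv}) in
  pc_root (u.1 + v.1) (u.2 ^+ (p ^ v.1) * v.2 ^+ (p ^ u.1)).
Definition pc_scale (a : R) (x : PC) : PC :=
  pc_mul (pc_root 0 a) x.

Let reprE m a : exists k,
  a ^+ (p ^ ((repr (pc_root m a : {eq_quot pc_equiv})).1 + k)) =
  (repr (pc_root m a : {eq_quot pc_equiv})).2 ^+ (p ^ (m + k)).
Proof.
apply/pc_rootP; rewrite [RHS]/pc_root -surjective_pairing.
by rewrite -[LHS](@reprK _ {eq_quot pc_equiv}).
Qed.

Lemma pc_oppE m a : pc_opp (pc_root m a) = pc_root m (- a).
Proof.
rewrite /pc_opp; have [k] := reprE m a; case: (repr _) => n b /= E.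
by apply/pc_rootP; exists k; rewrite !frN E.
Qed.

Lemma pc_addE m a n b : pc_add (pc_root m a) (pc_root n b) =
  pc_root (m + n) (a ^+ (p ^ n) + b ^+ (p ^ m)).
Proof.
rewrite /pc_add; have [k] := reprE m a; case: (repr _) => m' a' /= Ea.
have [l] := reprE n b; case: (repr _) => n' b' /= Eb.
apply/pc_rootP; exists (k + l)%N; rewrite !frD !frA; congr (_ + _).
  have -> : (n' + (m + n + (k + l)) = m + k + (n + n' + l))%N by lia.
  by rewrite -frA -Ea frA; congr (_ ^+ (p ^ _)); lia.
have -> : (m' + (m + n + (k + l)) = n + l + (m + m' + k))%N by lia.
by rewrite -frA -Eb frA; congr (_ ^+ (p ^ _)); lia.
Qed.

Lemma pc_mulE m a n b : pc_mul (pc_root m a) (pc_root n b) =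
  pc_root (m + n) (a ^+ (p ^ n) * b ^+ (p ^ m)).
Proof.
rewrite /pc_mul; have [k] := reprE m a; case: (repr _) => m' a' /= Ea.
have [l] := reprE n b; case: (repr _) => n' b' /= Eb.
apply/pc_rootP; exists (k + l)%N; rewrite !exprMn !frA; congr (_ * _).
  have -> : (n' + (m + n + (k + l)) = m + k + (n + n' + l))%N by lia.
  by rewrite -frA -Ea frA; congr (_ ^+ (p ^ _)); lia.
have -> : (m' + (m + n + (k + l)) = n + l + (m + m' + k))%N by lia.
by rewrite -frA -Eb frA; congr (_ ^+ (p ^ _)); lia.
Qed.

Let common3 (x y z : PC) : exists m a b c,
  [/\ x = pc_root m a, y = pc_root m b & z = pc_root m c].
Proof.
have [[m [a ->]] [n [b ->]]] := (pc_rootW x, pc_rootW y).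
have [l [c ->]] := pc_rootW z; exists (m + n + l)%N.
exists (a ^+ (p ^ (n + l))), (b ^+ (p ^ (m + l))), (c ^+ (p ^ (m + n))).
split; [rewrite (up (n + l)) | rewrite (up (m + l)) | rewrite (up (m + n))];
  congr pc_root; lia.
Qed.

Let addE1 m a b : pc_add (pc_root m a) (pc_root m b) = pc_root m (a + b).
Proof. by rewrite pc_addE (up m m) frD. Qed.

Let mulE1 m a b :
  pc_mul (pc_root m a) (pc_root m b) = pc_root m (a * b).
Proof. by rewrite pc_mulE (up m m) exprMn. Qed.

Let E0 m : pc_root 0 0 = pc_root m 0.
Proof. by rewrite (up m) fr0. Qed.

Let E1 m : pc_root 0 1 = pc_root m 1.
Proof. by rewrite (up m) expr1n. Qed.

Let pc_addA : associative pc_add.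
Proof.
move=> x y z; have [m [a [b [c [-> -> ->]]]]] := common3 x y z.
by rewrite !addE1 addrA.
Qed.

Let pc_addC : commutative pc_add.
Proof.
move=> x y; have [m [a [b [_ [-> -> _]]]]] := common3 x y x.
by rewrite !addE1 addrC.
Qed.

Let pc_add0 : left_id (pc_root 0 0) pc_add.
Proof. by move=> x; have [m [a ->]] := pc_rootW x; rewrite (E0 m) addE1 add0r. Qed.

Let pc_addN : left_inverse (pc_root 0 0) pc_opp pc_add.
Proof.
by move=> x; have [m [a ->]] := pc_rootW x; rewrite pc_oppE addE1 addNr -E0.
Qed.

HB.instance Definition _ :=
  GRing.isZmodule.Build PC pc_addA pc_addC pc_add0 pc_addN.

Let pc_mulA : associative pc_mul.
Proof.
move=> x y z; have [m [a [b [c [-> -> ->]]]]] := common3 x y z.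
by rewrite !mulE1 mulrA.
Qed.

Let pc_mulC : commutative pc_mul.
Proof.
move=> x y; have [m [a [b [_ [-> -> _]]]]] := common3 x y x.
by rewrite !mulE1 mulrC.
Qed.

Let pc_mul1 : left_id (pc_root 0 1) pc_mul.
Proof. by move=> x; have [m [a ->]] := pc_rootW x; rewrite (E1 m) mulE1 mul1r. Qed.

Let pc_mulD : left_distributive pc_mul pc_add.
Proof.
move=> x y z; have [m [a [b [c [-> -> ->]]]]] := common3 x y z.
by rewrite !(addE1, mulE1) mulrDl.
Qed.

Let pc_neq0 : pc_root 0 1 != 0.
Proof.
apply/eqP => /pc_rootP[k]; rewrite expr1n fr0 => /eqP.
by rewrite oner_eq0.
Qed.

HB.instance Definition _ := GRing.Zmodule_isComNzRing.Build PC
  pc_mulA pc_mulC pc_mul1 pc_mulD pc_neq0.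

Let pc_scaleA a b x : pc_scale a (pc_scale b x) = pc_scale (a * b) x.
Proof. by rewrite /pc_scale pc_mulA mulE1. Qed.

Let pc_scale1 : left_id 1 pc_scale.
Proof. exact: pc_mul1. Qed.

Let pc_scaleDr : right_distributive pc_scale +%R.
Proof. by move=> a x y; rewrite /pc_scale ![pc_mul (pc_root 0 a) _]pc_mulC pc_mulD. Qed.

Let pc_scaleDl x : {morph pc_scale^~ x : a b / a + b}.
Proof. by move=> a b; rewrite /pc_scale -addE1 pc_mulD. Qed.

(* R acts on its perfect closure through the canonical map a |-> pc_root 0 a. *)
HB.instance Definition _ := GRing.Zmodule_isLmodule.Build R PC
  pc_scaleA pc_scale1 pc_scaleDr pc_scaleDl.

(* Agreement with the description of PC as R_red with p^m-th roots adjoined. *)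
Lemma pc_rootX m a : pc_root m a ^+ (p ^ m) = pc_root 0 a.
Proof.
have X n (x : R) : pc_root m x ^+ n = pc_root m (x ^+ n).
  elim: n => [|n IH]; first by rewrite !expr0 -E1.
  by rewrite !exprS IH -mulE1.
by rewrite X [RHS](up m).
Qed.

Lemma pc_root0_eq0 a : pc_root 0 a = 0 <-> exists n, a ^+ n = 0.
Proof.
split=> [/pc_rootP[k]|[n an0]]; first by rewrite fr0; exists (p ^ (0 + k))%N.
apply/pc_rootP; exists n; rewrite fr0 add0n.
have /ltnW le_n : (n < p ^ n)%N by rewrite ltn_expl ?prime_gt1 ?(pcharf_prime chRp).
by rewrite -(subnK le_n) exprD an0 mulr0.
Qed.

End PerfectClosure.

Definition F_coherent (R : comNzRingType) (p : nat) (chRp : p \in [pchar R]) :=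
  noetherian R /\ coherent (perfect_closure chRp).

(* Main.v *)
(* Write S for the perfect closure, x_1, ..., x_d for the parameters, n for the
   maximal ideal of S, the radical of (x), and x^(1/q) for (x_1^(1/q), ..., x_d^(1/q)).
   The colimit T_j(V) of the Koszul homologies H_j(x^(1/q); V) over q = p^e is
   Tor_j(S / n, V); it vanishes for V = S and j > 0 because S is perfect and
   reduced, and for j > d.

   Frobenius and a length count give the monomial property: the product of the
   x_i^(1 - 1/q) is never in (x) S.  Otherwise the length of R / (x_1^t, ..., x_d^t)
   would grow more slowly than t^d, which contradicts dim R = d (by Artin-Rees).
   Hence T_d(S / (x)) <> 0.  Since S is coherent, S / (x) has finite free syzygies;
   the d-th one is free because its T_1 vanishes, and T_d(S / (x)) <> 0 says that
   the last map of the resolution is not injective modulo n.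

   Let c > 0 be maximal with H_c(x; S) <> 0.  Tensoring the last map of the
   resolution with H_c(x; S) is not injective, and moving along the resolution this
   produces a nonzero class in H_(c + d)(x; S / (x)), which is absurd.  So the Koszul
   complex of x on S is acyclic, and by coherence and Nakayama x is regular. *)

(* The obstacle is that S need not be Noetherian: coherence only makes kernels between finite free
   modules finitely generated, which is just what Nakayama needs. Hence two direct systems of Koszul
   complexes are run side by side. The roots x^(1/q) detect freeness, because the ideals they
   generate exhaust n; the constant system x carries the homology that has to vanish. Neither Tor
   nor a quotient such as S / (x) is formed. For A inside F with T_(j+1)(F) = 0, the vanishing of
   T_(j+1)(F / A) means that T_j(A) -> T_j(F) is injective. So the nonzero T_d becomes
   non-injectivity in degree d - 1 for A = (x), and the final absurdity is non-injectivity of A -> S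
   in degree c + d - 1 >= d, where a Koszul complex on d elements has no nonzero boundaries. Lengths
   are not numbers either: an upper bound is a filtration with factors A / m, a lower bound is a
   chain of ideals, and the two are only compared. *)
From HB Require Import structures.
Require Import Defs.
From mathcomp Require Import all_boot all_algebra boolp classical_sets.
From mathcomp Require Import zify ring.
Set Implicit Arguments.
Unset Strict Implicit.
Unset Printing Implicit Defensive.
Import GRing.Theory.
Local Open Scope classical_set_scope.
Local Open Scope ring_scope.

(** * Noetherian rings *)

Section Submodules.
Variables (A : comNzRingType) (V : lmodType A).
Implicit Types (N K : set V) (u v : V) (gs : seq V).

Lemma submod0 N : is_submodule N -> N 0. Proof. by case. Qed.
Lemma submodD N u v : is_submodule N -> N u -> N v -> N (u + v).
Proof. by case=> _ + _; apply. Qed.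
Lemma submodZ N a u : is_submodule N -> N u -> N (a *: u).
Proof. by case=> _ _; apply. Qed.
Lemma submodN N u : is_submodule N -> N u -> N (- u).
Proof. by rewrite -scaleN1r; apply: submodZ. Qed.
Lemma submodB N u v : is_submodule N -> N u -> N v -> N (u - v).
Proof. by move=> sN Nu Nv; apply: submodD => //; apply: submodN. Qed.
Lemma submodDr N u v : is_submodule N -> N v -> N (u + v) -> N u.
Proof. by move=> sN Nv Nuv; rewrite -(addrK v u); apply: submodB. Qed.
Lemma submod_sum N I (r : seq I) (P : pred I) (F : I -> V) : is_submodule N ->
  (forall i, P i -> N (F i)) -> N (\sum_(i <- r | P i) F i).
Proof.
by move=> sN NF; elim/big_ind: _ => //; [apply: submod0 | move=> *; apply: submodD].
Qed.

(** Spanning is phrased through submodules instead of coefficients, so that containment in a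
    submodule is checked on generators. *)
Definition generates gs N :=
  (forall g, g \in gs -> N g) /\
  forall K, is_submodule K -> (forall g, g \in gs -> K g) -> forall v, N v -> K v.

Lemma fg_coef N : finitely_generated N -> exists n (g : 'I_n -> V),
  (forall i, N (g i)) /\
  forall v, N v -> exists c : 'I_n -> A, v = \sum_i c i *: g i.
Proof.
move=> [n [phi phiN]]; exists n, (fun i => phi (delta_mx 0 i)); split=> [i|v].
  by rewrite -phiN; exists (delta_mx 0 i).
rewrite -phiN => -[w _ <-]; exists (fun i => w 0 i).
rewrite {1}[w]row_sum_delta linear_sum; apply: eq_bigr => i _.
by rewrite linearZ.
Qed.

Lemma fg_generates N : finitely_generated N -> exists gs, generates gs N.
Proof.
move=> /fg_coef[n [g [gN spang]]]; exists [seq g i | i <- enum 'I_n]; split.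
  by move=> _ /mapP[i _ ->].
move=> K sK gK v /spang[c ->]; apply: submod_sum => // i _.
by apply: submodZ => //; apply/gK/mapP; exists i; rewrite ?mem_enum.
Qed.

Definition rowcomb n (g : 'I_n -> V) (w : 'rV[A]_n) : V := \sum_i w 0 i *: g i.

Lemma rowcomb_is_linear n (g : 'I_n -> V) : linear (rowcomb g).
Proof.
move=> a u v; rewrite /rowcomb scaler_sumr -big_split; apply: eq_bigr => i _ /=.
by rewrite !mxE scalerDl scalerA.
Qed.

HB.instance Definition _ n (g : 'I_n -> V) :=
  GRing.isLinear.Build A 'rV[A]_n V _ (rowcomb g) (rowcomb_is_linear g).

Lemma rowcomb_delta n (g : 'I_n -> V) i : rowcomb g (delta_mx 0 i) = g i.
Proof.
rewrite /rowcomb (bigD1 i) //= mxE !eqxx scale1r big1 ?addr0 // => j /negPf ne_ji.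
by rewrite mxE eqxx ne_ji scale0r.
Qed.

Lemma range_submodule (U : lmodType A) (f : {linear U -> V}) :
  is_submodule (range f).
Proof.
split=> [|_ _ [u _ <-] [v _ <-]|a _ [u _ <-]]; first by exists 0; rewrite ?linear0.
  by exists (u + v); rewrite ?linearD.
by exists (a *: u); rewrite ?linearZ.
Qed.

Lemma generates_fg gs N : is_submodule N -> generates gs N -> finitely_generated N.
Proof.
move=> sN [gN Ng]; pose g (i : 'I_(size gs)) := gs`_i.
exists (size gs), (rowcomb g); apply/predeqP => v; split=> [[w _ <-]|].
  by apply: submod_sum => // i _; apply: submodZ => //; apply/gN/mem_nth.
apply: Ng => [|h gsh]; first exact: range_submodule.
have lt_h : (index h gs < size gs)%N by rewrite index_mem.
by exists (delta_mx 0 (Ordinal lt_h)); rewrite //= rowcomb_delta /g nth_index.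
Qed.

End Submodules.

Section HilbertBasis.
Variable A : comNzRingType.
Hypothesis A_noeth : noetherian A.

(* A polynomial of I of degree at least N has its leading coefficient in the
   ideal of leading coefficients of the elements of I of degree N. *)
Theorem hilbert_basis : noetherian {poly A}.
Proof.
move=> I sI.
pose L (J : set {poly A}) n : set A^o :=
  [set a | exists f : {poly A}, [/\ J f, (size f <= n.+1)%N & f`_n = a]].
have sL J n : is_submodule (J : set {poly A}^o) -> is_submodule (L J n).
  move=> sJ; split=> [|_ _ [f [Jf sf <-]] [g [Jg sg <-]]|a _ [f [Jf sf <-]]].
  - by exists 0; split; rewrite ?coef0 ?size_poly0 //; apply: submod0 sJ.
  - exists (f + g); split; rewrite ?coefD //; first exact: submodD sJ _ _.
    by rewrite (leq_trans (size_polyD _ _)) // geq_max sf.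
  - exists (a%:P * f); split; rewrite ?coefCM //; first exact: (submodZ a%:P sJ Jf).
    by rewrite mul_polyC (leq_trans (size_scale_leq _ _)).
have Lmon J n k : is_submodule (J : set {poly A}^o) -> (n <= k)%N ->
    forall a, L J n a -> L J k a.
  move=> sJ le_nk a [f [Jf sf fa]]; exists ('X^(k - n) * f); split.
  - exact: (submodZ ('X^(k - n)) sJ Jf).
  - have [->|f0] := eqVneq f 0; first by rewrite mulr0 size_poly0.
    by rewrite size_monicM ?monicXn // size_polyXn; lia.
  - by rewrite coefXnM ltnNge leq_subr /= subKn.
(* An increasing union of ideals; a bound for its finitely many generators gives the degree [N] from
   which it is constant. *)
pose LL : set A^o := [set a | exists n, L I n a].
have sLL : is_submodule LL.
  split=> [|a b [n La] [k Lb]|a b [n Lb]].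
  - by exists 0%N; apply: submod0 (sL _ _ sI).
  - exists (n + k)%N; apply: submodD (sL _ _ sI) _ _.
      by apply: Lmon La; rewrite ?leq_addr.
    by apply: Lmon Lb; rewrite ?leq_addl.
  - by exists n; apply: submodZ (sL _ _ sI) _.
have [N LN] : exists N, forall a, LL a -> L I N a.
  have [gs [gL genL]] := fg_generates (A_noeth sLL).
  suff [N gN] : exists N, forall g, g \in gs -> L I N g.
    by exists N; exact: (genL _ (sL _ _ sI) gN).
  elim: gs gL {genL} => [_|g gs IH gL]; first by exists 0%N.
  have [h hgs|N gN] := IH; first by apply: gL; rewrite inE hgs orbT.
  have [n Ln] := gL g (mem_head _ _); exists (n + N)%N => h.
  rewrite inE => /orP[/eqP->|/gN Lh].
    by apply: Lmon Ln; rewrite ?leq_addr.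
  by apply: Lmon Lh; rewrite ?leq_addl.
pose good n (gs : seq {poly A}) :=
    (forall f, f \in gs -> I f /\ (size f <= n.+1)%N) /\
    forall K : set A^o, is_submodule K -> (forall f, f \in gs -> K f`_n) ->
      forall a, L I n a -> K a.
have [fs fsP] : {fs & forall n, good n (fs n)}.
  apply: choice => n; have [gs [gL genL]] := fg_generates (A_noeth (sL _ n sI)).
  suff [fs [fsI fsgs]] : exists fs : seq {poly A},
      (forall f, f \in fs -> I f /\ (size f <= n.+1)%N) /\
      gs = [seq (f`_n : A^o) | f : {poly A} <- fs].
    exists fs; split=> // K sK Kfs; apply: genL => // g.
    by rewrite fsgs => /mapP[f /Kfs ? ->].
  elim: gs gL {genL} => [_|g gs IH gL]; first by exists [::].
  have [h hgs|fs [fsI ->]] := IH; first by apply: gL; rewrite inE hgs orbT.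
  have [f [If sf <-]] := gL g (mem_head _ _); exists (f :: fs); split=> // h.
  by rewrite inE => /orP[/eqP->|/fsI].
apply: (@generates_fg {poly A} {poly A}^o (flatten [seq fs n | n <- iota 0 N.+1])) => //.
split.
  by move=> f /flattenP[_ /mapP[n _ ->] /(fsP n).1[]].
move=> J sJ Jfs f.
have LJ n : (n <= N)%N -> forall a, L I n a -> L (I `&` J)%classic n a.
  move=> le_nN; apply: (fsP n).2 => [|f' fs'].
    by apply: sL; split=> [|u v [? ?] [? ?]|a u [? ?]]; split;
      (apply: submod0 || apply: submodD || apply: submodZ).
  have [If' sf'] := (fsP n).1 _ fs'; exists f'; split=> //; split=> //.
  apply: Jfs; apply/flattenP; exists (fs n) => //.
  by apply: map_f; rewrite mem_iota ltnS.
have [s] := ubnP (size f); elim: s f => // s IH f le_fs If.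
have [->|f0] := eqVneq f 0; first exact: submod0 sJ.
have szf : size f = (size f).-1.+1 by rewrite prednK // size_poly_gt0.
have Lf : L I (size f).-1 (lead_coef f) by exists f; rewrite -szf.
(* [g] has the leading coefficient of [f] in the same degree, so f - g has smaller size and
   induction applies. *)
have [g [[Ig Jg] sg glead]] : L (I `&` J)%classic (size f).-1 (lead_coef f).
  have [/LJ|/ltnW le_N] := leqP (size f).-1 N; first exact.
  have sIJ : is_submodule ((I `&` J)%classic : set {poly A}^o).
    by split=> [|u v [? ?] [? ?]|a u [? ?]]; split;
      (apply: submod0 || apply: submodD || apply: submodZ).
  by apply: (Lmon _ _ _ sIJ le_N); apply: LJ => //; apply: LN; exists (size f).-1.
apply: (@submodDr _ _ J f (- g) sJ); first exact: submodN sJ _.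
apply: IH; last exact: submodB sI _ _.
rewrite -ltnS; apply: leq_trans le_fs; rewrite ltnS szf; apply/leq_sizeP => j.
rewrite leq_eqVlt => /orP[/eqP<-|lt_j]; first by rewrite coefB glead subrr.
by rewrite coefB !nth_default ?subrr // -?szf; apply: leq_trans lt_j; rewrite // -szf.
Qed.

End HilbertBasis.

(** * Lengths *)

Section Chains.
Variable A : comNzRingType.
Implicit Types (I J K L B : set A) (a b f r z : A) (n k : nat).

Lemma ideal0 I : is_ideal I -> I 0. Proof. exact: submod0. Qed.
Lemma idealD I a b : is_ideal I -> I a -> I b -> I (a + b).
Proof. exact: submodD. Qed.
Lemma idealN I a : is_ideal I -> I a -> I (- a).
Proof. exact: submodN. Qed.
Lemma idealB I a b : is_ideal I -> I a -> I b -> I (a - b).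
Proof. exact: submodB. Qed.
Lemma idealMl I a b : is_ideal I -> I b -> I (a * b).
Proof. exact: submodZ. Qed.
Lemma idealMr I a b : is_ideal I -> I a -> I (a * b).
Proof. by rewrite mulrC; apply: idealMl. Qed.
Lemma ideal_sum I T (s : seq T) (P : pred T) (F : T -> A) : is_ideal I ->
  (forall i, P i -> I (F i)) -> I (\sum_(i <- s | P i) F i).
Proof. exact: submod_sum. Qed.

Lemma idealT : is_ideal [set: A]. Proof. by []. Qed.
Lemma idealI I J : is_ideal I -> is_ideal J -> is_ideal (I `&` J).
Proof.
move=> iI iJ; split=> [|u v [Iu Ju] [Iv Jv]|a u [Iu Ju]].
- by split; apply: ideal0.
- by split; apply: idealD.
- by split; apply: idealMl.
Qed.

(** This is J + K f; [adjoin] is the case K = A. *)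
Definition shift J K f : set A := [set a | exists2 k, K k & J (a - k * f)].
Definition adjoin J f := shift J setT f.

Lemma ideal_shift J K f : is_ideal J -> is_ideal K -> is_ideal (shift J K f).
Proof.
move=> iJ iK; split=> [|u v [k Kk Jk] [l Kl Jl]|a u [k Kk Jk]].
- by exists 0; rewrite ?mul0r ?subr0; apply: ideal0.
- exists (k + l); first exact: idealD.
  by rewrite mulrDl opprD addrACA; apply: idealD.
- exists (a * k); first exact: idealMl.
  by rewrite -mulrA -mulrBr; apply: idealMl.
Qed.

Lemma ideal_adjoin J f : is_ideal J -> is_ideal (adjoin J f).
Proof. by move=> iJ; apply: ideal_shift => //; apply: idealT. Qed.

Lemma sub_shift J K f : is_ideal K -> J `<=` shift J K f.
Proof. by move=> iK a Ja; exists 0; rewrite ?mul0r ?subr0 //; apply: ideal0. Qed.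

Lemma sub_adjoin J f : J `<=` adjoin J f.
Proof. exact: sub_shift idealT. Qed.

Lemma mem_adjoin J f : is_ideal J -> adjoin J f f.
Proof. by move=> iJ; exists 1; rewrite // mul1r subrr; apply: ideal0. Qed.

Lemma adjoin_sub J K f : is_ideal K -> J `<=` K -> K f -> adjoin J f `<=` K.
Proof.
by move=> iK JK Kf a [r _ /JK h]; rewrite -(subrK (r * f) a); apply: idealD => //;
  apply: idealMl.
Qed.

(** A certificate that J / I has length at least n. The bottom is only required to contain I, so
    that I may be shrunk and J enlarged. *)
Fixpoint has_chain I J n : Prop :=
  if n is n'.+1 then
    exists L, [/\ is_ideal L, has_chain I L n', L `<=` J & exists2 b, J b & ~ L b]
  else I `<=` J.

Lemma chain_sub I J n : has_chain I J n -> I `<=` J.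
Proof. by elim: n J => //= n IH J [L [_ /IH IL LJ _]]; apply: subset_trans IL LJ. Qed.

Lemma chain_enlarge I J K n : has_chain I J n -> J `<=` K -> has_chain I K n.
Proof.
case: n => [|n] /=; first exact: subset_trans.
move=> [L [iL h LJ [b Jb Lb]]] JK; exists L; split=> //; first exact: subset_trans JK.
by exists b => //; apply: JK.
Qed.

Lemma chain_shrink I I' J n : I' `<=` I -> has_chain I J n -> has_chain I' J n.
Proof.
move=> I'I; elim: n J => [J|n IH J] /=; first exact: subset_trans.
by move=> [L [iL /IH h LJ JL]]; exists L.
Qed.

Lemma chain_cat I J K n k :
  has_chain I J n -> has_chain J K k -> has_chain I K (n + k).
Proof.
move=> hn; elim: k K => [K|k IH K] /=; first by rewrite addn0; apply: chain_enlarge.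
by rewrite addnS => -[L [iL /IH h LJ JL]]; exists L.
Qed.

(** The hypothesis says that (J : z) lies in I. If b z were in J + L z with L above I, then b - l
    would be in I for some l in L, so b in L: strict steps stay strict. *)
Lemma chain_shift I J K z n : is_ideal J -> (forall r, J (r * z) -> I r) ->
  has_chain I K n -> has_chain J (shift J K z) n.
Proof.
move=> iJ Jz; have iz := Jz 0; rewrite mul0r in iz.
elim: n K => [K IK|n IH K] /=.
  by move=> a Ja; exists 0; [apply: IK; apply: iz; apply: ideal0 | rewrite mul0r subr0].
move=> [L [iL h LK [b Kb Lb]]]; exists (shift J L z); split.
- exact: ideal_shift.
- exact: IH.
- by move=> a [l Ll Jl]; exists l => //; apply: LK.
exists (b * z); first by exists b; rewrite ?subrr //; apply: ideal0.
move=> [l Ll]; rewrite -mulrBl => /Jz Ibl; apply: Lb.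
by rewrite -(subrK l b); apply: idealD => //; apply: chain_sub h _ Ibl.
Qed.

Section Certificates.
Variable m : set A.
Hypothesis m_max : is_maximal_ideal m.

Let im : is_ideal m. Proof. by case: m_max => -[]. Qed.

Lemma max_inv r : ~ m r -> exists s, m (1 - s * r).
Proof.
move=> mr; have [[_ m1] mmax] := m_max.
have [|nprop] := pselect (adjoin m r 1); first by case=> s _; exists s.
case: mr; rewrite -(mmax (adjoin m r)); [exact: mem_adjoin | | exact: sub_adjoin].
by split=> //; apply: ideal_adjoin.
Qed.

(* J / I has a filtration with n factors, each a quotient of A / m. *)
Fixpoint length_le I J n : Prop :=
  if n is n'.+1 then
    exists J' a, [/\ is_ideal J', I `<=` J', forall b, m b -> J' (b * a),
                     J `<=` adjoin J' a & length_le I J' n']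
  else J `<=` I.

(** Modulo J', J is at most one copy of A / m. If L lies in J', the top step is dropped; otherwise L
    already covers J modulo J', and the step from L to J survives intersection with J'. *)
Lemma chain_drop I J J' a n : is_ideal J -> is_ideal J' -> I `<=` J' ->
  (forall b, m b -> J' (b * a)) -> J `<=` adjoin J' a ->
  has_chain I J n.+1 -> has_chain I (J `&` J') n.
Proof.
move=> + iJ' IJ' mJ'; elim: n J => [|n IH] J iJ JJ' [L [iL h LJ [w Jw Lw]]].
  move=> b Ib; split; last exact: IJ'.
  exact: LJ _ (h _ Ib).
have [LJ'|nLJ'] := pselect (L `<=` J').
  by apply: (chain_enlarge (n := n.+1) h) => b Lb; split; [apply: LJ | apply: LJ'].
have [b Lb J'b] : exists2 b, L b & ~ J' b.
  by apply: contra_notP nLJ' => nex b Lb; apply: contrapT => J'b; apply: nex; exists b.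
exists (L `&` J'); split.
- exact: idealI.
- by apply: IH => //; apply: subset_trans JJ'.
- by move=> c [/LJ].
have [r _ J'br] := JJ' b (LJ _ Lb).
have [|s ms] := @max_inv r.
  by move=> /mJ' /(idealD iJ' J'br); rewrite subrK.
have [t _ J'wt] := JJ' w Jw; exists (w - t * s * b); last first.
  move=> [Lwb _]; apply: Lw.
  by rewrite -(subrK (t * s * b) w); apply: idealD => //; apply: idealMl.
split; first by apply: idealB => //; apply: idealMl => //; apply: LJ.
(* Modulo J', b is r a and w is t a, while s inverts r modulo m; so t s b agrees with w. *)
have -> : w - t * s * b =
    (w - t * a) - (t * s) * (b - r * a) + t * ((1 - s * r) * a).
  by ring.
by apply: idealD => //; [apply: idealB | ] => //; apply: idealMl => //; apply: mJ'.
Qed.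

(** Each factor of the filtration accounts for at most one strict step of the chain. *)
Lemma chain_length I J n N : is_ideal J ->
  has_chain I J N -> length_le I J n -> (N <= n)%N.
Proof.
elim: n J N => [|n IH] J [|N] iJ //.
  by move=> [L [_ h _ [b Jb Lb]]] JI; case: Lb; apply: chain_sub h _ (JI _ Jb).
move=> h /= [J' [a [iJ' IJ' mJ' JJ' len]]]; rewrite ltnS; apply: IH len => //.
by apply: chain_enlarge (chain_drop iJ iJ' IJ' mJ' JJ' h) _ => b [].
Qed.

Lemma length_sub I J K n : K `<=` J -> length_le I J n -> length_le I K n.
Proof.
case: n => [|n] KJ /=; first exact: subset_trans.
by move=> [J' [a [iJ' IJ' mJ' JJ' len]]]; exists J', a; split=> //;
  apply: subset_trans JJ'.
Qed.

Lemma length_cat I J K n k : I `<=` J ->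
  length_le I J n -> length_le J K k -> length_le I K (n + k).
Proof.
move=> IJ hn; elim: k K => [K KJ|k IH K [J' [a [iJ' JJ' mJ' KJ' len]]]].
  by rewrite addn0; apply: length_sub hn.
by rewrite addnS; exists J', a; split=> //; [apply: subset_trans JJ' | apply: IH].
Qed.

Lemma length_shift I J K f n : is_ideal J -> is_ideal I -> (forall b, I b -> J (b * f)) ->
  length_le I K n -> length_le J (shift J K f) n.
Proof.
move=> iJ iI IJ; elim: n K => [K KI a [k /KI/IJ Jkf Jak]|n IH K].
  by rewrite -(subrK (k * f) a); apply: idealD.
move=> [K' [a [iK' IK' mK' KK' len]]]; exists (shift J K' f), (a * f); split.
- exact: ideal_shift.
- exact: sub_shift.
- by move=> b mb; exists (b * a); [exact: mK' | rewrite mulrA subrr; apply: ideal0].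
- move=> c [k /KK'[r _ K'kr] Jck]; exists r => //; exists (k - r * a) => //.
  by have -> : c - r * (a * f) - (k - r * a) * f = c - k * f by ring.
- exact: IH.
Qed.

Lemma length_adjoin I J f n : is_ideal J -> is_ideal I ->
  (forall b, I b -> J (b * f)) -> length_le I setT n -> length_le J (adjoin J f) n.
Proof. exact: length_shift. Qed.

(* The factors of the filtration are spanned by the monomials
   [prod_(i < k) y_i ^ a_i f] with a_i < Q.  The second part saves the last one. *)
Section Box.
Variables (d Q : nat) (y : nat -> A) (B : set A) (n : nat).
Hypothesis iB : is_ideal B.
(** Equivalent to B lying in the ideal of the y_i with i < d, in the form in which it is applied. *)
Hypothesis yB : forall J f, is_ideal J ->
  (forall i, (i < d)%N -> J (y i * f)) -> forall b, B b -> J (b * f).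
Hypothesis lenB : length_le B setT n.

Let layers M J f k j N : is_ideal J ->
  (forall l, (j <= l < M)%N ->
     length_le (adjoin J (y k ^+ l.+1 * f))
       (adjoin (adjoin J (y k ^+ l.+1 * f)) (y k ^+ l * f)) N) ->
  (j <= M)%N ->
  length_le (adjoin J (y k ^+ M * f)) (adjoin J (y k ^+ j * f)) (N * (M - j)).
Proof.
move=> iJ; move Ee: (M - j)%N => e; elim: e j Ee => [|e IH] j Ee h le_j.
  by rewrite muln0; have -> : j = M by lia.
have lt_j : (j < M)%N by lia.
rewrite mulnS addnC; apply: (@length_cat _ (adjoin J (y k ^+ j.+1 * f))).
- apply: adjoin_sub; [exact: ideal_adjoin | exact: sub_adjoin|].
  have -> : M = ((M - j.+1) + j.+1)%N by lia.
  by rewrite exprD -mulrA; apply: idealMl; [apply: ideal_adjoin | apply: mem_adjoin].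
- by apply: IH => [|l /andP[lt_l lt_lM]|]; [lia | apply: h; lia | lia].
- apply: length_sub (h j _); last by lia.
  apply: adjoin_sub; first by do 2!apply: ideal_adjoin.
    by move=> a Ja; do 2!apply: sub_adjoin.
  by apply: mem_adjoin; apply: ideal_adjoin.
Qed.

(** The factor between exponents l and l + 1 of y_k is generated by y_k^l f, which y_k itself now
    kills: this is the induction on k. *)
Let layer k J f l : (k < d)%N -> is_ideal J -> (forall i, (i < k)%N -> J (y i ^+ Q * f)) ->
  (forall i, (k < i < d)%N -> J (y i * f)) ->
  let J' := adjoin J (y k ^+ l.+1 * f) in let f' := y k ^+ l * f in
  [/\ is_ideal J', forall i, (i < k)%N -> J' (y i ^+ Q * f')
    & forall i, (k <= i < d)%N -> J' (y i * f')].
Proof.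
move=> lt_k iJ hQ h1 J' f'; split=> [|i lt_i|i]; first exact: ideal_adjoin.
  by apply: sub_adjoin; rewrite mulrCA; apply: idealMl => //; apply: hQ.
rewrite leq_eqVlt => /andP[/orP[/eqP<-|lt_ki] lt_id].
  by rewrite mulrA -exprS; apply: mem_adjoin.
by apply: sub_adjoin; rewrite mulrCA; apply: idealMl => //; apply: h1; lia.
Qed.

Lemma length_box k J f : (k <= d)%N -> is_ideal J ->
  (forall i, (i < k)%N -> J (y i ^+ Q * f)) ->
  (forall i, (k <= i < d)%N -> J (y i * f)) ->
  length_le J (adjoin J f) (n * Q ^ k).
Proof.
elim: k J f => [|k IH] J f le_k iJ hQ h1.
  by rewrite expn0 muln1; apply: length_adjoin lenB => //; apply: yB.
have := @layers Q J f k 0 (n * Q ^ k) iJ _ (leq0n _).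
rewrite expr0 mul1r subn0 expnSr mulnA => h; rewrite -[(_ * Q)%N]add0n.
apply: length_cat (h _).
- exact: sub_adjoin.
- by apply: adjoin_sub => //; apply: hQ.
move=> l /= lt_l.
have hQk i : (i < k)%N -> J (y i ^+ Q * f) by move=> ?; apply: hQ; lia.
have [iJ' hQ' h1'] := layer l le_k iJ hQk h1.
by apply: IH => //; apply: ltnW.
Qed.

Lemma length_box_pred k J f : (0 < Q)%N -> (k <= d)%N -> is_ideal J ->
  (forall i, (i < k)%N -> J (y i ^+ Q * f)) ->
  (forall i, (k <= i < d)%N -> J (y i * f)) ->
  J ((\prod_(i < k) y i) ^+ Q.-1 * f) ->
  length_le J (adjoin J f) (n * (Q ^ k).-1).
Proof.
move=> Q0; elim: k J f => [|k IH] J f le_k iJ hQ h1 hprod.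
  rewrite expn0 muln0 /=; apply: adjoin_sub => //.
  by move: hprod; rewrite big_ord0 expr1n mul1r.
have hQk i : (i < k)%N -> J (y i ^+ Q * f) by move=> ?; apply: hQ; lia.
(* The monomial lies in the highest layer of y_k, so induction saves a block there; the other Q - 1
   layers are counted in full. *)
have top : length_le J (adjoin J (y k ^+ Q.-1 * f)) (n * (Q ^ k).-1).
  apply: IH => //; first exact: ltnW.
  - by move=> i lt_i; rewrite mulrCA; apply: idealMl => //; apply: hQk.
  - move=> i; rewrite leq_eqVlt => /andP[/orP[/eqP<-|lt_ki] lt_id].
      by rewrite mulrA -exprS prednK //; apply: hQ.
    by rewrite mulrCA; apply: idealMl => //; apply: h1; lia.
  - by move: hprod; rewrite big_ord_recr /= exprMn mulrA.
have := @layers Q.-1 J f k 0 (n * Q ^ k) iJ _ (leq0n _).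
rewrite expr0 mul1r subn0 => h.
have -> : (n * (Q ^ k.+1).-1 = n * (Q ^ k).-1 + n * Q ^ k * Q.-1)%N.
  have Qk : (0 < Q ^ k)%N by rewrite expn_gt0 Q0.
  rewrite expnSr -mulnA -mulnDr; congr (_ * _)%N; nia.
apply: length_cat top (h _); first exact: sub_adjoin.
move=> l /= lt_l; have [iJ' hQ' h1'] := layer l le_k iJ hQk h1.
by apply: length_box => //; apply: ltnW.
Qed.
End Box.

End Certificates.
End Chains.

(** * Dimension and the growth of lengths *)

Section ArtinRees.
Variable A : comNzRingType.
Implicit Types (X I J P : set A) (a b r z : A) (s t : nat).

(* The powers of the ideal generated by X. *)
Inductive ipow X : nat -> set A :=
| ipowT a : ipow X 0 a
| ipow0 t : ipow X t 0
| ipowD t a b : ipow X t a -> ipow X t b -> ipow X t (a + b)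
| ipowM t a b : X a -> ipow X t b -> ipow X t.+1 (a * b).

Lemma ideal_ipow X t : is_ideal (ipow X t).
Proof.
split=> [|u v|a u]; [exact: ipow0 | exact: ipowD |].
elim=> {t u} [u|t|t u v _ IHu _ IHv|t u v Xu _ IHv]; first exact: ipowT.
- by rewrite scaler0; apply: ipow0.
- by rewrite scalerDr; apply: ipowD.
- by rewrite /GRing.scale /= mulrCA; apply: ipowM.
Qed.

Lemma ipow_le X s t : (s <= t)%N -> ipow X t `<=` ipow X s.
Proof.
move=> + a Xa; elim: Xa s => {t a} [a|t|t a b _ IHa _ IHb|t a b Xa _ IHb] s le_st.
- by move: le_st; rewrite leqn0 => /eqP->; apply: ipowT.
- exact: ipow0.
- by apply: ipowD; [apply: IHa | apply: IHb].
- by case: s le_st => [|s] le_st; [apply: ipowT | apply: ipowM; last apply: IHb].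
Qed.

Lemma ipow_mul X s t a b : ipow X s a -> ipow X t b -> ipow X (s + t) (a * b).
Proof.
move=> + Xb; elim=> {s a} [a|s|s a a' _ IHa _ IHa'|s a a' Xa _ IHa'].
- exact: idealMl (ideal_ipow _ _) Xb.
- by rewrite mul0r; apply: ipow0.
- by rewrite mulrDl; apply: ipowD.
- by rewrite -mulrA; apply: ipowM.
Qed.

Lemma ipow_exp X t a : X a -> ipow X t (a ^+ t).
Proof.
by move=> Xa; elim: t => [|t IH]; [apply: ipowT | rewrite exprS; apply: ipowM].
Qed.

Lemma ipow_sub X P t : is_ideal P -> X `<=` P -> ipow X t.+1 `<=` P.
Proof.
move=> iP XP a; move Et: t.+1 => t1 Xa.
elim: Xa Et => {t1 a} [a|t1|t1 a b _ IHa _ IHb|t1 a b Xa _ _] // Et.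
- exact: ideal0.
- by apply: idealD => //; [exact: IHa Et | exact: IHb Et].
- by apply: idealMr => //; apply: XP.
Qed.

Definition isum I J : set A := [set a | exists2 b, I b & J (a - b)].

Lemma ideal_isum I J : is_ideal I -> is_ideal J -> is_ideal (isum I J).
Proof.
move=> iI iJ; split=> [|u v [b Ib Jb] [c Ic Jc]|a u [b Ib Jb]].
- by exists 0; rewrite ?subr0; apply: ideal0.
- by exists (b + c); [apply: idealD | rewrite opprD addrACA; apply: idealD].
- by exists (a * b); [apply: idealMl | rewrite -mulrBr; apply: idealMl].
Qed.

Lemma isum_subl I J : is_ideal J -> I `<=` isum I J.
Proof. by move=> iJ a Ia; exists a; rewrite ?subrr //; apply: ideal0. Qed.

Lemma isum_subr I J : is_ideal I -> J `<=` isum I J.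
Proof. by move=> iI a Ja; exists 0; rewrite ?subr0 //; apply: ideal0. Qed.

Lemma isum_sub I J K : is_ideal K -> I `<=` K -> J `<=` K -> isum I J `<=` K.
Proof.
by move=> iK IK JK a [b /IK Kb /JK Kab]; rewrite -(subrK b a); apply: idealD.
Qed.

Definition rees X : set {poly A} := [set f | forall t, ipow X t f`_t].

Lemma rees_mul X (f g : {poly A}) : rees X f -> rees X g -> rees X (f * g).
Proof.
move=> Rf Rg t; rewrite coefM; apply: ideal_sum; first exact: ideal_ipow.
move=> i _; have /subnKC {1}<- : (i <= t)%N by rewrite -ltnS.
exact: ipow_mul.
Qed.

(* A Noetherian presentation of the Rees algebra A[x T, x in xs]. *)
Lemma rees_cover X (xs : seq A) : noetherian A -> (forall x, x \in xs -> X x) ->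
  exists (B : comNzRingType) (phi : {rmorphism B -> {poly A}}),
    [/\ noetherian B, forall a, exists b : B, phi b = a%:P,
        forall x, x \in xs -> exists b : B, phi b = x *: 'X
      & forall b : B, rees X (phi b)].
Proof.
move=> noethA; elim: xs => [_|x xs IH Xxs].
  exists A, (@polyC A); split=> // [a|b t]; first by exists a.
  rewrite coefC; case: eqP => [->|_]; [exact: ipowT | exact: ipow0].
have [|B [phi [noethB phiC phiX phiR]]] := IH.
  by move=> y xsy; apply: Xxs; rewrite inE xsy orbT.
have cphi : commr_rmorph phi (x *: 'X) by move=> b; apply: mulrC.
exists {poly B}, (horner_morph cphi); split; first exact: hilbert_basis.
- by move=> a; have [b <-] := phiC a; exists b%:P; rewrite /= horner_morphC.
- move=> y; rewrite inE => /orP[/eqP->|/phiX[b <-]].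
    by exists 'X; rewrite /= horner_morphX.
  by exists b%:P; rewrite /= horner_morphC.
move=> f; suff: rees X (map_poly phi f).[x *: 'X] by []; elim/poly_ind: f => [|f b IHf].
  by rewrite rmorph0 horner0 => t; rewrite coef0; apply: ipow0.
rewrite rmorphD rmorphM /= map_polyX map_polyC hornerMXaddC => t.
rewrite coefD; apply: ipowD; last exact: phiR.
apply: rees_mul => // {}t; rewrite coefZ coefX.
case: t => [|[|t]]; rewrite ?mulr0; try exact: ipow0.
rewrite mulr1 -[x]expr1; apply: ipow_exp.
by apply: Xxs; rewrite inE eqxx.
Qed.

(** Artin-Rees in the domain A / P for the ideal (z). In the Noetherian cover of the Rees algebra,
    the elements with all coefficients in P + (z) form a finitely generated ideal, and c bounds the
    sizes of its generators. *)
Lemma artin_rees (xs : seq A) P z : noetherian A -> is_prime_ideal P -> ~ P z ->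
  let I t := isum (ipow [set x | x \in xs] t) P in
  exists c, forall t r, I t (r * z) -> I (t - c)%N r.
Proof.
move=> noethA [[iP _] Pprime] Pz I.
have iX t : is_ideal (ipow [set x | x \in xs] t) by exact: ideal_ipow.
have [//|B [phi [noethB phiC phiX phiR]]] := @rees_cover [set x | x \in xs] xs noethA.
have phiI t a : ipow [set x | x \in xs] t a -> exists b : B, phi b = a *: 'X^t.
  elim=> {t a} [a|t|t a a' _ [b eb] _ [b' eb']|t a a' xsa _ [b' eb']].
  - by have [b eb] := phiC a; exists b; rewrite eb expr0 alg_polyC.
  - by exists 0; rewrite rmorph0 scale0r.
  - by exists (b + b'); rewrite rmorphD eb eb' scalerDl.
  - have [b eb] := phiX _ xsa; exists (b * b').
    by rewrite rmorphM eb eb' -scalerAl -scalerAr scalerA exprS.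
pose J : set B^o := [set b | forall t, adjoin P z (phi b)`_t].
have sJ : is_submodule J.
  have iPz := ideal_adjoin z iP.
  split=> [t|b b' Jb Jb' t|b b' Jb' t].
  - by rewrite rmorph0 coef0; apply: ideal0.
  - by rewrite rmorphD coefD; apply: idealD.
  - rewrite rmorphM coefM; apply: ideal_sum => // i _; exact: idealMl.
have [n [g [gJ spang]]] := fg_coef (noethB _ sJ).
have [u uP] : {u : 'I_n -> nat -> A & forall i t, P ((phi (g i))`_t - u i t * z)}.
  have uex (i : 'I_n) : exists ui : nat -> A, forall t, P ((phi (g i))`_t - ui t * z).
    have /choice[ui uiP] : forall t, exists r, P ((phi (g i))`_t - r * z).
      by move=> t; have [r _ Pr] := gJ i t; exists r.
    by exists ui.
  exact: choice uex.
pose c := \max_(i < n) size (phi (g i)); exists c => t r [a Xa Pa].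
have [b eb] := phiI _ _ Xa.
have /spang[h eh] : J b.
  move=> t'; rewrite eb coefZ coefXn; case: (t' == t).
    by rewrite mulr1; exists r => //; rewrite -opprB; apply: idealN.
  by rewrite mulr0; apply: ideal0 (ideal_adjoin z iP).
(* The coefficient of T^t in the sum of the h_i g_i, divided by z modulo P: the j-th coefficient of
   g_i is u_ij z modulo P and vanishes for j >= c, so only coefficients of h_i in the power t - c
   enter. *)
pose w := \sum_i \sum_(j < t.+1 | (j < c)%N) (phi (h i))`_(t - j) * u i j.
have Xw : ipow [set x | x \in xs] (t - c) w.
  apply: ideal_sum => // i _; apply: ideal_sum => // j lt_jc.
  apply: idealMr => //; apply: (@ipow_le _ _ (t - j)%N); first by apply: leq_sub2l; apply: ltnW.
  exact: phiR.
exists w => //.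
suff Paw : P (a - w * z).
  have : P ((r - w) * z).
    have -> : (r - w) * z = (r * z - a) + (a - w * z) by ring.
    exact: idealD.
  by case/Pprime.
have -> : a = (phi b)`_t by rewrite eb coefZ coefXn eqxx mulr1.
rewrite eh rmorph_sum coef_sum /w mulr_suml -sumrB.
apply: ideal_sum => // i _; rewrite rmorphM coefMr mulr_suml [X in _ - X]big_mkcond /=.
rewrite -sumrB; apply: ideal_sum => // j _; case: ltnP => [lt_jc|le_cj].
  by rewrite -mulrA -mulrBr; apply: idealMl.
rewrite subr0 [X in _ * X]nth_default ?mulr0; first exact: ideal0.
by apply: leq_trans le_cj; apply: (leq_bigmax i).
Qed.

(** Take z in P_1 outside P_0, and J the ideal at exponent t. Then A / (J + (z)) maps onto the
    quotient for P_1, of length at least s^n, and (J + (z)) / J is by Artin-Rees at least as long as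
    the quotient at exponent t - c. Doing this s times gives s^(n + 1). *)
Lemma chain_lower (xs : seq A) m n (P : nat -> set A) : noetherian A ->
  is_proper_ideal m -> (forall x, x \in xs -> m x) -> P n `<=` m ->
  (forall i, (i <= n)%N -> is_prime_ideal (P i)) ->
  (forall i, (i < n)%N -> P i `<` P i.+1) ->
  exists c, forall s, (0 < s)%N ->
    has_chain (isum (ipow [set x | x \in xs] (c * s)) (P 0%N)) setT (s ^ n).
Proof.
move=> noethA [im m1] xsm; elim: n P => [|n IH] P Pnm Pprime Plt.
  exists 1%N => s s0; rewrite expn0 mul1n; exists (isum (ipow [set x | x \in xs] s) (P 0%N)).
  have [iP0 _] := (Pprime 0%N isT).1.
  split=> //; first by apply: ideal_isum => //; apply: ideal_ipow.
  exists 1 => // h; apply: m1; apply: isum_sub h => //.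
  by case: s s0 => // s _; apply: ipow_sub.
have [|i|i|c' hc'] := IH (fun i => P i.+1).
- exact: Pnm.
- exact: (Pprime i.+1).
- exact: (Plt i.+1).
have [z P1z P0z] : exists2 z, P 1%N z & ~ P 0%N z.
  have [_ nsub] := Plt 0%N isT.
  by apply: contra_notP nsub => nex b Pb; apply: contrapT => P0b; apply: nex; exists b.
have P0prime := Pprime 0%N isT; have [[iP0 _] _] := P0prime.
have [[iP1 _] _] := Pprime 1%N isT.
have iX t : is_ideal (ipow [set x | x \in xs] t) by exact: ideal_ipow.
have [c hc] := artin_rees xs noethA P0prime P0z.
exists (c' + c)%N => s s0; rewrite mulnDl expnS [(s * _)%N]mulnC.
(* Each of the k rounds costs c in the exponent, and c' s must remain for the chain above P_1. *)
suff h k t : (c' * s + c * k <= t)%N ->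
    has_chain (isum (ipow [set x | x \in xs] t) (P 0%N)) setT (s ^ n * k) by exact: h.
elim: k t => [|k IHk] t le_t; first by rewrite muln0.
have iI u : is_ideal (isum (ipow [set x | x \in xs] u) (P 0%N)) by exact: ideal_isum.
rewrite mulnS addnC.
apply: (@chain_cat _ _ (adjoin (isum (ipow [set x | x \in xs] t) (P 0%N)) z)).
  apply: (@chain_shift _ (isum (ipow [set x | x \in xs] (t - c)) (P 0%N))) => //.
    by move=> r; apply: hc.
  by apply: IHk; nia.
apply: chain_shrink (hc' s s0); apply: adjoin_sub; first exact: ideal_isum.
  apply: isum_sub; first exact: ideal_isum.
    by apply: (subset_trans _ (isum_subl iP1)); apply: ipow_le; nia.
  by apply: (subset_trans (Plt 0%N isT).1); apply: isum_subr.
exact: isum_subr.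
Qed.
End ArtinRees.

(** * The monomial property *)

Section Combinations.
Variable A : comNzRingType.
Implicit Types (d : nat) (y : nat -> A).

(** Sequences are functions on [nat] cut off at d, so that all initial segments share one
    function. *)
Definition combs d y : set A :=
  [set a | exists c : nat -> A, a = \sum_(i < d) c i * y i].

Lemma ideal_combs d y : is_ideal (combs d y).
Proof.
split=> [|u v [c ->] [c' ->]|a u [c ->]].
- by exists (fun=> 0); rewrite big1 // => i _; rewrite mul0r.
- exists (fun i => c i + c' i); rewrite -big_split; apply: eq_bigr => i _ /=.
  by rewrite mulrDl.
- exists (fun i => a * c i); rewrite [a *: _]mulr_sumr; apply: eq_bigr => i _.
  by rewrite mulrA.
Qed.

Lemma mem_combs d y i : (i < d)%N -> combs d y (y i).
Proof.
move=> lt_i; exists (fun j => (j == i)%:R); rewrite (bigD1 (Ordinal lt_i)) //=.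
rewrite eqxx mul1r big1 ?addr0 // => j /eqP ne_j; case: eqP => [e|_]; last exact: mul0r.
by case: ne_j; apply: val_inj.
Qed.

Lemma combs_sub d y (I : set A) : is_ideal I -> (forall i, (i < d)%N -> I (y i)) ->
  combs d y `<=` I.
Proof.
by move=> iI Iy a [c ->]; apply: ideal_sum => // i _; apply: idealMl => //; apply: Iy.
Qed.

Lemma frob_sum p (chA : p \in [pchar A]) e I (r : seq I) (P : pred I) (F : I -> A) :
  (\sum_(i <- r | P i) F i) ^+ (p ^ e) = \sum_(i <- r | P i) F i ^+ (p ^ e).
Proof.
elim/big_rec2: _ => [|i u v _ <-].
  by rewrite expr0n expn_eq0 eqn0Ngt prime_gt0 ?(pcharf_prime chA).
by rewrite exprDn_pchar // pnatX pnatE ?(pcharf_prime chA) ?chA.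
Qed.

Lemma combs_frob p (chA : p \in [pchar A]) e d y a :
  combs d y a -> combs d (fun i => y i ^+ (p ^ e)) (a ^+ (p ^ e)).
Proof.
move=> [c ->]; rewrite (frob_sum chA); exists (fun i => c i ^+ (p ^ e)).
by apply: eq_bigr => i _; rewrite exprMn.
Qed.
End Combinations.

Section LocalRings.
Variables (A : comNzRingType) (m : set A).

Lemma local_proper_sub (I : set A) : is_local_ring m -> is_proper_ideal I -> I `<=` m.
Proof.
move=> [_ m_unique] [iI I1].
pose S (X : set A) := X = set0 \/ is_proper_ideal X /\ I `<=` X.
have [F FS Ftot|M [SM Mmax]] := @Zorn_bigcup A S.
  have [F0|] := pselect (forall X, F X -> X = set0).
    by left; apply/predeqP => a; split=> // -[X FX]; rewrite (F0 X FX).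
  move=> /existsNP[X0 /not_implyP[FX0 X00]]; right.
  have [[iX0 _] IX0] : is_proper_ideal X0 /\ I `<=` X0 by case: (FS _ FX0).
  have prop X a : F X -> X a -> is_proper_ideal X.
    by move=> FX Xa; case: (FS _ FX) => [X_0|[]//]; rewrite X_0 in Xa.
  split; last by move=> a /IX0; exists X0.
  split; last by move=> [X FX X1]; have [_] := prop _ _ FX X1.
  split=> [|u v [X FX Xu] [Y FY Yv]|a u [X FX Xu]].
  - by exists X0 => //; apply: ideal0.
  - have [[iX _] [iY _]] := (prop _ _ FX Xu, prop _ _ FY Yv).
    case: (Ftot _ _ FX FY) => [XY|YX]; [exists Y | exists X] => //; apply: idealD => //.
      exact: XY.
    exact: YX.
  - by exists X => //; apply: idealMl => //; case: (prop _ _ FX Xu).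
have ne_M : M <> set0.
  move=> M0; apply: (Mmax I); last by right; split.
  by rewrite M0; split; [apply: sub0set | move/(_ 0 (ideal0 iI))].
have [Mp IM] : is_proper_ideal M /\ I `<=` M by case: SM.
rewrite -(m_unique M) //; split=> // J Jp MJ; apply: contrapT => neMJ.
apply: (Mmax J); last by right; split=> //; apply: subset_trans MJ.
by split=> // JM; apply: neMJ; apply/seteqP.
Qed.

Lemma local_unit a : is_local_ring m -> ~ m a -> exists b, b * a = 1.
Proof.
move=> lm ma; have [[r _ /eqP]|nprop] := pselect (adjoin [set 0] a 1).
  by rewrite subr_eq0 => /eqP h; exists r.
have i0 : is_ideal [set 0 : A].
  by split=> [//|u v -> ->|b u ->]; rewrite ?addr0 //= [_ *: _]mulr0.
case: ma; apply: (local_proper_sub lm (I := adjoin [set 0] a)); last exact: mem_adjoin.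
by split=> //; apply: ideal_adjoin.
Qed.

Lemma finite_length_param d (x : nat -> A) : noetherian A -> is_maximal_ideal m ->
  (forall a, m a -> exists n, combs d x (a ^+ n)) ->
  exists n, length_le m (combs d x) setT n.
Proof.
move=> noethA m_max xm; have [[im m1] _] := m_max.
have [gs [gm genm]] := fg_generates (noethA m im).
have icx := ideal_combs d x.
have [Q hQ] : exists Q, forall g, g \in gs -> combs d x (g ^+ Q).
  elim: gs gm {genm} => [|g gs IH] gm; first by exists 0%N.
  have [h hgs|Q hQ] := IH; first by apply: gm; rewrite inE hgs orbT.
  have [n hn] := xm g (gm g (mem_head _ _)); exists (n + Q)%N => h.
  rewrite inE exprD => /orP[/eqP->|/hQ hh]; first exact: idealMr.
  exact: idealMl.
have len1 : length_le m m setT 1.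
  exists m, 1; split=> // [b mb|b _]; first by rewrite mulr1.
  by exists b; rewrite // mulr1 subrr; apply: ideal0.
exists (1 * Q ^ size gs)%N; apply: (@length_sub _ _ _ (adjoin (combs d x) 1)).
  by move=> b _; exists b; rewrite // mulr1 subrr; apply: ideal0.
(* The box consists of monomials in generators of m, not in the x_i; Q is a common exponent that
   puts these generators into (x). *)
apply: (@length_box _ m (size gs) Q (nth 0 gs) m) => //.
- move=> J f iJ Jf; apply: genm => [|g /(nthP 0)[i lt_i <-]]; last exact: Jf.
  split=> [|u v Ju Jv|a u Ju]; rewrite ?mul0r ?mulrDl; first exact: ideal0.
    exact: idealD.
  by rewrite -mulrA; apply: idealMl.
- by move=> i lt_i; rewrite mulr1; apply: hQ; apply: mem_nth.
- by move=> i; lia.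
Qed.
End LocalRings.

Lemma bernoulli_nat N e : (N ^ e + e * N ^ e.-1 <= N.+1 ^ e)%N.
Proof.
elim: e => [|[|e] IH]; rewrite ?expn0 ?expn1 ?mul0n ?mul1n ?addn1 //.
have := leq_mul (leqnn N.+1) IH; rewrite -expnS => /(leq_trans _); apply.
by rewrite /= !expnS; nia.
Qed.

(* If the monomial were in the ideal, the length of A / (x_i^t) for t = Q^e would
   be at most a constant times (Q^d - 1)^e, which is too small for dimension d. *)
Theorem monomial_property (A : comNzRingType) (m : set A) p (chA : p \in [pchar A])
    d (x : nat -> A) e :
  noetherian A -> is_local_ring m -> has_prime_chain A d ->
  (forall i, (i < d)%N -> m (x i)) ->
  (forall a, m a -> exists n, combs d x (a ^+ n)) ->
  ~ combs d (fun i => x i ^+ (p ^ e)) ((\prod_(i < d) x i) ^+ (p ^ e).-1).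
Proof.
move=> noethA lm [P [Pprime Plt]] xm radx; set Q := (p ^ e)%N => hprod.
have m_max := lm.1; have [mprop _] := m_max; have [im m1] := mprop.
case: e @Q hprod => [|e] Q hprod.
  apply: m1; apply: (combs_sub im xm); move: hprod; rewrite /Q expn0 expr0.
  by congr combs; apply: funext.
have Q1 : (1 < Q)%N by rewrite -{1}[1%N](expn0 p) ltn_exp2l // prime_gt1 ?(pcharf_prime chA).
have Q0 : (0 < Q)%N by rewrite expn_gt0 prime_gt0 ?(pcharf_prime chA).
have [n0 len0] := finite_length_param noethA m_max radx.
(* Passing from k to k + 1 is a box in y_i = x_i^(Q^k). Frobenius carries the assumed membership to
   the y_i, so the factor is Q^d - 1 instead of Q^d. *)
have upper k : length_le m (combs d (fun i => x i ^+ (Q ^ k))) setT (n0 * (Q ^ d).-1 ^ k).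
  elim: k => [|k IH].
    by rewrite expn0 muln1; move: len0; congr length_le; congr combs; apply: funext.
  apply: (@length_sub _ _ _ (adjoin (combs d (fun i => x i ^+ (Q ^ k.+1))) 1)).
    by move=> b _; exists b; rewrite // mulr1 subrr; apply: ideal0 (ideal_combs _ _).
  rewrite [((Q ^ d).-1 ^ _)%N]expnSr mulnA.
  apply: (length_box_pred (d := d) (y := fun i => x i ^+ (Q ^ k)) _ _ IH) => //.
  - exact: ideal_combs.
  - move=> J f iJ Jf b [c ->]; rewrite mulr_suml; apply: ideal_sum => // i _.
    by rewrite -mulrA; apply: idealMl => //; apply: Jf.
  - exact: ideal_combs.
  - move=> i lt_i; rewrite mulr1 -exprM -expnSr.
    exact: (@mem_combs A d (fun i => x i ^+ (Q ^ k.+1))).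
  - by move=> i; lia.
  rewrite mulr1 prodrXl -exprM mulnC exprM.
  have -> : (fun i => x i ^+ (Q ^ k.+1)) = (fun i => (x i ^+ Q) ^+ (p ^ (e.+1 * k))).
    by apply: funext => i; rewrite -exprM expnS expnM.
  by rewrite -[(Q ^ k)%N]expnM; apply: combs_frob.
have [|c hc] := @chain_lower A [seq x i | i <- iota 0 d] m d P noethA mprop _
    (local_proper_sub lm (Pprime d (leqnn d)).1) Pprime Plt.
  by move=> _ /mapP[i + ->]; rewrite mem_iota => /xm.
(* The chain for s = Q^j is set against the filtration for Q^(c + j); they fit because c < Q^c gives
   c Q^j <= Q^(c + j). *)
have growth j : ((Q ^ d) ^ j <= n0 * (Q ^ d).-1 ^ c * (Q ^ d).-1 ^ j)%N.
  rewrite -mulnA -expnD -expnM mulnC expnM.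
  apply: (chain_length m_max _ _ (upper (c + j)%N)) => //.
  apply: chain_shrink (hc _ _); last by rewrite expn_gt0 Q0.
  have [[iP0 _] _] := Pprime 0%N isT.
  apply: combs_sub => [|i lt_i]; first by apply: ideal_isum => //; apply: ideal_ipow.
  apply: isum_subl => //; apply: (@ipow_le _ _ _ (Q ^ (c + j))).
    by rewrite expnD leq_mul2r orbC ltnW // ltn_expl.
  by apply: ipow_exp; apply: map_f; rewrite mem_iota.
have QdE : (Q ^ d = (Q ^ d).-1.+1)%N by rewrite prednK // expn_gt0 Q0.
move: (Q ^ d).-1 QdE growth => N ->; move: (n0 * _)%N => C growth.
(* The exponent e = C N + 1 is chosen so that e N^(e - 1) alone exceeds C N^e. *)
have := leq_trans (bernoulli_nat N (C * N).+1) (growth _).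
rewrite [_.+1.-1]/= !expnS; case: N {growth} => [|N]; first by rewrite muln0 mul0n.
have : (0 < N.+1 ^ (C * N.+1))%N by rewrite expn_gt0.
nia.
Qed.

(** * Koszul complexes *)

Section Koszul.
Variable S : comNzRingType.
Implicit Types (U V W : lmodType S) (x z : nat -> S).

Definition prodM U V : lmodType S := HB.pack_for (lmodType S) (U * V)%type.

(** The term of degree j + 1. Degree 0 stays outside the recursion so that it is V by conversion for
    every d. *)
Fixpoint kosS V d j : lmodType S :=
  if d is d'.+1
  then prodM (kosS V d' j) (if j is j'.+1 then kosS V d' j' else V)
  else 'rV[S]_0.

(* The j-th term of the Koszul complex on d elements with coefficients in V;
   a pair (a, b) stands for a + e_d b, where e_0, ..., e_d is the basis. *)
Definition kos V d j : lmodType S := if j is j'.+1 then kosS V d j' else V.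

(** The convention is d(a + e_d b) = d a + x_d b - e_d (d b): adding an element forms the mapping
    cone of x_d. *)
Fixpoint dif V x d j : kos V d j.+1 -> kos V d j :=
  if d is d'.+1 then
    if j is j'.+1 then
      fun a : kos V d'.+1 j'.+2 =>
        ((@dif V x d' j'.+1 a.1 + x d' *: a.2, - @dif V x d' j' a.2) : kos V d'.+1 j'.+1)
    else fun a : kos V d'.+1 1 => @dif V x d' 0%N a.1 + x d' *: a.2
  else fun=> 0.

Fixpoint kmapS V W (f : V -> W) d j : kosS V d j -> kosS W d j :=
  if d is d'.+1 then
    if j is j'.+1 then
      fun a : kosS V d'.+1 j'.+1 =>
        ((kmapS f (d := d') (j := j'.+1) a.1, kmapS f (d := d') (j := j') a.2) : kosS W d'.+1 j'.+1)
    else fun a : kosS V d'.+1 0 =>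
        ((kmapS f (d := d') (j := 0%N) a.1, f a.2) : kosS W d'.+1 0)
  else fun=> 0.

Definition kmap V W (f : V -> W) d j : kos V d j -> kos W d j :=
  if j is j'.+1 then @kmapS V W f d j' else f.

(** Induced by e_i -> z_i e_i; a chain map from the complex of x to that of x' when x_i = z_i
    x'_i. *)
Fixpoint tauS V z d j : kosS V d j -> kosS V d j :=
  if d is d'.+1 then
    if j is j'.+1 then
      fun a : kosS V d'.+1 j'.+1 =>
        ((@tauS V z d' j'.+1 a.1, z d' *: @tauS V z d' j' a.2) : kosS V d'.+1 j'.+1)
    else fun a : kosS V d'.+1 0 =>
        ((@tauS V z d' 0%N a.1, z d' *: a.2) : kosS V d'.+1 0)
  else fun=> 0.

Definition tau V z d j : kos V d j -> kos V d j :=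
  if j is j'.+1 then @tauS V z d j' else id.

Lemma kos0 V j (a b : kos V 0 j.+1) : a = b.
Proof. by rewrite [a]thinmx0 [b]thinmx0. Qed.

Lemma kos_top V d j (a : kos V d j) : (d < j)%N -> a = 0.
Proof.
elim: d j a => [|d IH] [|j] // a lt_dj; first exact: kos0.
case: a => a b; congr (_, _); first by apply: (IH j.+1); apply: ltnW.
by case: j b lt_dj {a} => // j b lt_dj; apply: (IH j.+1).
Qed.

Lemma dif_is_linear V x d j : linear (@dif V x d j).
Proof.
elim: d j => [|d IH] [|j] r a b; rewrite ?scaler0 ?addr0 //.
  have -> : dif x (r *: a + b) =
    dif x (r *: (a.1 : kos V d 1) + b.1) + x d *: (r *: (a.2 : kos V d 0) + b.2) by [].
  by rewrite IH !scalerDr !scalerA mulrC addrACA.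
have -> : dif x (r *: a + b) =
    (dif x (r *: (a.1 : kos V d j.+2) + b.1) + x d *: (r *: (a.2 : kos V d j.+1) + b.2),
     - dif x (r *: (a.2 : kos V d j.+1) + b.2)) by [].
rewrite !IH opprD -scalerN scalerDr scalerA mulrC -scalerA addrACA -scalerDr.
by [].
Qed.
HB.instance Definition _ V x d j := GRing.isLinear.Build S (kos V d j.+1) (kos V d j) _
  (@dif V x d j) (@dif_is_linear V x d j).

Lemma kmap_is_linear V W (f : {linear V -> W}) d j : linear (@kmap V W f d j).
Proof.
case: j => [|j]; first by move=> r a b; apply: linearP.
elim: d j => [|d IH] [|j] r a b; try exact: kos0.
  by congr (_, _); [apply: (IH 0%N) | apply: linearP].
by congr (_, _); [apply: (IH j.+1) | apply: (IH j)].
Qed.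
HB.instance Definition _ V W (f : {linear V -> W}) d j :=
  GRing.isLinear.Build S (kos V d j) (kos W d j) _ (@kmap V W f d j) (@kmap_is_linear V W f d j).

Lemma tau_is_linear V z d j : linear (@tau V z d j).
Proof.
case: j => [|j] //; elim: d j => [|d IH] [|j] r a b; try exact: kos0.
  congr (_, _); first exact: (IH 0%N).
  by rewrite scalerDr !scalerA mulrC -scalerA.
congr (_, _); first exact: (IH j.+1).
transitivity (z d *: (r *: tau z (a.2 : kos V d j.+1) + tau z (b.2 : kos V d j.+1))).
  by congr (_ *: _); apply: (IH j).
by rewrite scalerDr !scalerA mulrC -scalerA.
Qed.
HB.instance Definition _ V z d j :=
  GRing.isLinear.Build S (kos V d j) (kos V d j) _ (@tau V z d j) (@tau_is_linear V z d j).

Lemma dif_dif V x d j (a : kos V d j.+2) : dif x (dif x a) = 0.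
Proof.
elim: d j a => [|d IH] j a //; case: a => a b.
have dd0 : dif x (dif x (a : kos V d j.+2) + x d *: (b : kos V d j.+1)) +
    x d *: - dif x (b : kos V d j.+1) = 0.
  by rewrite linearD linearZ /= IH add0r scalerN subrr.
case: j a b dd0 => [|j] a b dd0; first exact: dd0.
have dd1 : - - dif x (dif x (b : kos V d j.+2)) = 0 by rewrite IH !oppr0.
exact: (congr2 (fun u v => (u, v) : kos V d.+1 j.+1) dd0 (etrans (congr1 -%R (linearN _ _)) dd1)).
Qed.

Lemma kmap_dif V W (f : {linear V -> W}) x d j (a : kos V d j.+1) :
  kmap f (dif x a) = dif x (kmap f a).
Proof.
elim: d j a => [|d IH] [|j] a; rewrite ?linear0 //.
  by rewrite [LHS]linearD linearZ; congr (_ + _); apply: (IH 0%N).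
case: a => a b.
have e1 : kmap f (dif x (a : kos V d j.+2) + x d *: (b : kos V d j.+1)) =
    dif x (kmap f (a : kos V d j.+2)) + x d *: kmap f (b : kos V d j.+1).
  by rewrite linearD linearZ; congr (_ + _); apply: IH.
have e2 : kmap f (- dif x (b : kos V d j.+1)) = - dif x (kmap f (b : kos V d j.+1)).
  by rewrite linearN; congr (- _); apply: IH.
by case: j {IH} a b e1 e2 => [|j] a b e1 e2; congr (_, _).
Qed.

Lemma tau_dif V x x' z d j (a : kos V d j.+1) : (forall i, x i = z i * x' i) ->
  tau z (dif x a) = dif x' (tau z a).
Proof.
move=> xz; elim: d j a => [|d IH] [|j] a //; rewrite ?linear0 //.
  have e1 : dif x (a.1 : kos V d 1) = dif x' (tau z (a.1 : kos V d 1)) := IH 0%N a.1.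
  have e2 : x d *: (a.2 : V) = x' d *: (z d *: (a.2 : V)) by rewrite scalerA mulrC -xz.
  exact: (congr2 +%R e1 e2).
case: a => a b.
have e1 : tau z (dif x (a : kos V d j.+2) + x d *: (b : kos V d j.+1)) =
    dif x' (tau z (a : kos V d j.+2)) + x' d *: (z d *: tau z (b : kos V d j.+1)).
  by rewrite linearD linearZ scalerA mulrC -xz; congr (_ + _); apply: IH.
have e2 : z d *: tau z (- dif x (b : kos V d j.+1)) =
    - dif x' (z d *: tau z (b : kos V d j.+1)).
  by rewrite linearN linearZ scalerN; congr (- (_ *: _)); apply: IH.
by case: j {IH} a b e1 e2 => [|j] a b e1 e2; congr (_, _).
Qed.

Lemma tau_kmap V W (f : {linear V -> W}) z d j (a : kos V d j) :
  kmap f (tau z a) = tau z (kmap f a).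
Proof.
case: j a => [|j] a //; elim: d j a => [|d IH] [|j] a; try exact: kos0; case: a => a b.
  by congr (_, _); [apply: (IH 0%N) | apply: linearZ].
congr (_, _); first exact: (IH j.+1).
have -> : z d *: tau z (kmap f (b : kos V d j.+1)) = kmap f (z d *: tau z (b : kos V d j.+1)).
  by rewrite linearZ; congr (_ *: _); rewrite [RHS]IH.
by [].
Qed.

Lemma tau1 V d j (a : kos V d j) : tau (fun=> 1) a = a.
Proof.
case: j a => [|j] a //; elim: d j a => [|d IH] [|j] a; try exact: kos0.
  by case: a => a b; congr (_, _); [apply: (IH 0%N) | apply: scale1r].
case: a => a b; congr (_, _); first exact: (IH j.+1).
by rewrite /= scale1r; apply: (IH j).
Qed.

Lemma kmap_comp U V W (f : U -> V) (g : V -> W) (h : U -> W) d j (a : kos U d j) :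
  (forall u, g (f u) = h u) -> kmap g (kmap f a) = kmap h a.
Proof.
move=> gf; case: j a => [|j] a; first exact: gf.
elim: d j a => [|d IH] [|j] a; try exact: kos0; case: a => a b.
  by congr (_, _); [apply: (IH 0%N) | apply: gf].
by congr (_, _); [apply: (IH j.+1) | apply: (IH j)].
Qed.

Lemma kmap_id V d j (a : kos V d j) : kmap id a = a.
Proof.
case: j a => // j; elim: d j => [|d IH] [|j] a; try exact: kos0.
  by case: a => a b; congr (_, _); apply: (IH 0%N).
by case: a => a b; congr (_, _); [apply: (IH j.+1) | apply: (IH j)].
Qed.

Lemma kmap_inj V W (f : V -> W) d j : injective f -> injective (@kmap V W f d j).
Proof.
move=> finj; case: j => [|j] //; elim: d j => [|d IH] [|j] a b; try by move=> _; apply: kos0.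
  by case: a b => a1 a2 [b1 b2] [/(IH 0%N)-> /finj->].
by case: a b => a1 a2 [b1 b2] [/(IH j.+1)-> /(IH j)->].
Qed.

Lemma kmap_surj V W (f : V -> W) d j : (forall w, exists v, f v = w) ->
  forall b, exists a, @kmap V W f d j a = b.
Proof.
move=> fsurj; case: j => [|j] //; elim: d j => [|d IH] [|j] b.
- by exists 0; apply: kos0.
- by exists 0; apply: kos0.
- case: b => b1 b2; have [[a1 <-] [a2 <-]] := (IH 0%N b1, fsurj b2).
  by exists (a1, a2).
- case: b => b1 b2; have [[a1 <-] [a2 <-]] := (IH j.+1 b1, IH j b2).
  by exists (a1, a2).
Qed.

Lemma kmap_exact U V W (f : U -> V) (g : V -> W) d j :
  (forall v, g v = 0 -> exists u, f u = v) ->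
  forall b, @kmap V W g d j b = 0 -> exists a, @kmap U V f d j a = b.
Proof.
move=> gf; case: j => [|j] //; elim: d j => [|d IH] [|j] b.
- by exists 0; apply: kos0.
- by exists 0; apply: kos0.
- case: b => b1 b2 [/(IH 0%N)[a1 <-] /gf[a2 <-]].
  by exists (a1, a2).
- case: b => b1 b2 [/(IH j.+1)[a1 <-] /(IH j)[a2 <-]].
  by exists (a1, a2).
Qed.

Lemma kmap_sum V W I (r : seq I) (h : I -> V -> W) (f : V -> W) d j (a : kos V d j) :
  (forall v, \sum_(i <- r) h i v = f v) -> \sum_(i <- r) kmap (h i) a = kmap f a.
Proof.
move=> hf; case: j a => [|j] a; first exact: hf.
have sum_pair (X Y : lmodType S) (F : I -> X) (G : I -> Y) :
    \sum_(i <- r) ((F i, G i) : prodM X Y) = (\sum_(i <- r) F i, \sum_(i <- r) G i).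
  by elim: r {hf} => [|i r IH]; rewrite ?big_nil // !big_cons IH.
elim: d j a => [|d IH] [|j] a; try exact: kos0.
  by case: a => a b; apply: etrans (sum_pair _ _ _ _) _; congr (_, _);
    [apply: (IH 0%N) | apply: hf].
by case: a => a b; apply: etrans (sum_pair _ _ _ _) _; congr (_, _);
  [apply: (IH j.+1) | apply: (IH j)].
Qed.

End Koszul.
Arguments dif : simpl never.
Arguments kmap : simpl never.
Arguments tau : simpl never.

(** * Direct systems of Koszul complexes and their long exact sequences *)

Section KoszulSystems.
Variable S : comNzRingType.
Implicit Types (U V W : lmodType S).

Definition cycle V (x : nat -> S) d j : kos V d j -> Prop :=
  if j is j'.+1 then fun a : kos V d j'.+1 => dif x a = 0 else fun=> True.

Section System.
Variables (x z : nat -> nat -> S).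
Hypothesis xz : forall e i, x e i = z e i * x e.+1 i.

Fixpoint taus V d j e k (a : kos V d j) : kos V d j :=
  if k is k'.+1 then tau (z (e + k')) (taus e k' a) else a.

Lemma taus_is_linear V d j e k : linear (@taus V d j e k).
Proof. by elim: k => //= k IH r a b; rewrite IH linearP. Qed.
HB.instance Definition _ V d j e k :=
  GRing.isLinear.Build S (kos V d j) (kos V d j) _ (@taus V d j e k) (@taus_is_linear V d j e k).

Lemma tausD V d j e k l (a : kos V d j) : taus e (k + l) a = taus (e + k) l (taus e k a).
Proof. by elim: l => [|l IH]; rewrite ?addn0 // addnS /= IH addnA. Qed.

Lemma taus_dif V d j e k (a : kos V d j.+1) :
  taus e k (dif (x e) a) = dif (x (e + k)) (taus e k a).
Proof.
elim: k => [|k IH] /=; first by rewrite addn0.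
by rewrite IH addnS; apply: tau_dif => i; apply: xz.
Qed.

Lemma taus_kmap V W (f : {linear V -> W}) d j e k (a : kos V d j) :
  kmap f (taus e k a) = taus e k (kmap f a).
Proof. by elim: k => //= k IH; rewrite tau_kmap IH. Qed.

Lemma cycle_kmap V W (f : {linear V -> W}) d j e (a : kos V d j) :
  cycle (x e) a -> cycle (x e) (kmap f a).
Proof.
by case: j a => //= j a ca; rewrite -[LHS]kmap_dif ca [LHS](linear0 (kmap f (d := d) (j := j))).
Qed.

Lemma cycle_taus V d j e k (a : kos V d j) :
  cycle (x e) a -> cycle (x (e + k)) (taus e k a).
Proof. by case: j a => //= j a ca; rewrite -taus_dif ca linear0. Qed.

(* The class of a vanishes in the colimit of the Koszul homologies H_j(x_e; V). *)
Definition dies V d j e (a : kos V d j) :=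
  exists k (b : kos V d j.+1), dif (x (e + k)) b = taus e k a.

(* colim_e H_j(x_e; V) = 0 *)
Definition acyclic V d j := forall e (a : kos V d j), cycle (x e) a -> dies e a.

(* colim_e H_j(x_e; V) -> colim_e H_j(x_e; W) is injective. *)
Definition hinj V W (f : V -> W) d j := forall e (a : kos V d j) b,
  kmap f a = dif (x e) b -> dies e a.

Lemma dies_taus V d j e k (a : kos V d j) : dies (e + k) (taus e k a) -> dies e a.
Proof. by move=> [l [b eb]]; exists (k + l)%N, b; rewrite addnA eb tausD. Qed.

Lemma diesW V d j e (a : kos V d j) : dies e a -> exists k0, forall k, (k0 <= k)%N ->
  exists b : kos V d j.+1, dif (x (e + k)) b = taus e k a.
Proof.
move=> [k0 [b eb]]; exists k0 => k le_k; exists (taus (e + k0) (k - k0) b).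
have -> : (e + k = e + k0 + (k - k0))%N by lia.
by rewrite -taus_dif eb -tausD subnKC.
Qed.

Lemma diesD V d j e (a b : kos V d j) : dies e a -> dies e b -> dies e (a + b).
Proof.
move=> /diesW[k ha] /diesW[l hb].
have [a' ea] := ha _ (leq_addr l k); have [b' eb] := hb _ (leq_addl k l).
by exists (k + l)%N, (a' + b'); rewrite !linearD /= ea eb.
Qed.

Lemma dies_kmap V W (f : {linear V -> W}) d j e (a : kos V d j) :
  dies e a -> dies e (kmap f a).
Proof.
by move=> [k [b eb]]; exists k, (kmap f b); rewrite -taus_kmap -eb -kmap_dif.
Qed.

Section ShortExact.
Variables (A B C : lmodType S) (f : {linear A -> B}) (g : {linear B -> C}).
Hypotheses (finj : injective f) (gsurj : forall c, exists b, g b = c).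
Hypotheses (gf : forall a, g (f a) = 0) (fg : forall b, g b = 0 -> exists a, f a = b).

Let kmap_gf d j (a : kos A d j) : kmap g (kmap f a) = 0.
Proof.
rewrite (kmap_comp (h := fun=> 0)) // -(@kmap_sum S A C nat [::] (fun _ _ => 0)) ?big_nil //.
Qed.

(** If f a = d b, then g b is a cycle. Once it bounds, b differs by a boundary from an element of
    the complex of A, and that element bounds a. *)
Lemma hinj_of_acyclic d j : acyclic C d j.+1 -> hinj f d j.
Proof.
move=> acC e a b eab.
have [|k [c' ec']] := acC e (kmap g b).
  by rewrite /cycle -kmap_dif -eab kmap_gf.
have [b' eb'] := kmap_surj gsurj c'.
have [|a' ea'] := kmap_exact fg (b := taus e k b - dif (x (e + k)) b').
  by rewrite linearB /= kmap_dif eb' ec' taus_kmap subrr.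
exists k, a'; apply: (kmap_inj finj).
by rewrite kmap_dif ea' linearB /= dif_dif subr0 -taus_dif -eab taus_kmap.
Qed.

(** Lift the cycle to b. Then d b comes from A and dies there, so b can be corrected by the complex
    of A to a cycle over B. *)
Lemma acyclic_of_hinj d j : acyclic B d j.+1 -> hinj f d j -> acyclic C d j.+1.
Proof.
move=> acB finjH e c cc; have [b eb] := kmap_surj gsurj c.
have [|a ea] := kmap_exact fg (b := dif (x e) b); first by rewrite kmap_dif eb.
have [k [a' ea']] := finjH e a b ea.
apply: (@dies_taus _ _ _ _ k); have [|l [b'' eb'']] := acB (e + k)%N (taus e k b - kmap f a').
  by rewrite /cycle linearB /= -taus_dif -ea -taus_kmap -kmap_dif ea' subrr.
exists l, (kmap g b''); rewrite -kmap_dif eb'' taus_kmap linearB /=.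
by rewrite taus_kmap eb kmap_gf subr0.
Qed.
End ShortExact.

Lemma hinj_of_acyclic_sub V W (f : {linear V -> W}) d j :
  injective f -> acyclic V d j.+1 -> hinj f d j.+1.
Proof.
move=> finj acA e a b eab; apply: acA; apply: (kmap_inj finj).
by rewrite kmap_dif eab dif_dif (linear0 (kmap f (d := d) (j := j))).
Qed.

Lemma acyclic_sub_of_hinj V W (f : {linear V -> W}) d j :
  acyclic W d j.+1 -> hinj f d j.+1 -> acyclic V d j.+1.
Proof.
move=> acB finjH e a ca.
have [|k [b eb]] := acB e (kmap f a); first exact: (cycle_kmap f ca).
by apply: (@dies_taus _ _ _ _ k); apply: (finjH _ _ b); rewrite taus_kmap.
Qed.

Lemma hinj_top V W (f : {linear V -> W}) d j : injective f -> (d <= j)%N -> hinj f d j.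
Proof.
move=> finj le_dj e a b eab; exists 0%N, 0; rewrite linear0; apply: (kmap_inj finj).
by rewrite eab [b]kos_top // !linear0.
Qed.

Lemma acyclic_rV d j n : acyclic S^o d j -> acyclic 'rV[S]_n d j.
Proof.
move=> acS e a ca.
have lin_coord (i : 'I_n) : linear (fun v : 'rV[S]_n => v 0 i : S^o).
  by move=> r u v; rewrite !mxE.
have lin_delta (i : 'I_n) : linear (fun s : S^o => s *: delta_mx 0 i : 'rV[S]_n).
  by move=> r u v; rewrite scalerDl scalerA.
pose coord i : {linear _ -> _} := HB.pack (fun v : 'rV[S]_n => v 0 i : S^o)
  (GRing.isLinear.Build _ _ _ _ _ (lin_coord i)).
pose delta i : {linear _ -> _} := HB.pack (fun s : S^o => s *: delta_mx 0 i : 'rV[S]_n)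
  (GRing.isLinear.Build _ _ _ _ _ (lin_delta i)).
have -> : a = \sum_i kmap (delta i) (kmap (coord i) a).
  rewrite -{1}[a]kmap_id.
  rewrite -(@kmap_sum _ _ _ _ (index_enum 'I_n) (fun i v => delta i (coord i v))) => [|v].
    by apply: eq_bigr => i _; rewrite (kmap_comp (h := fun v => delta i (coord i v))).
  by rewrite -row_sum_delta.
elim/big_ind: _ => [|u v|i _]; first by exists 0%N, 0; rewrite !linear0.
  exact: diesD.
by apply: dies_kmap; apply: acS; apply: (cycle_kmap (coord i)).
Qed.

End System.
End KoszulSystems.

Section Homotopy.
Variables (S : comNzRingType) (V : lmodType S) (i : nat).

(** Exterior multiplication by e_i on the left; moving e_i past e_d gives the sign. It is a
    null-homotopy of multiplication by x_i. *)
Fixpoint hot d j : kos V d j -> kos V d j.+1 :=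
  if d is d'.+1 then
    if j is j'.+1 then
      fun a : kos V d'.+1 j'.+1 =>
        (if i == d' then (0, a.1) else (@hot d' j'.+1 a.1, - @hot d' j' a.2)) : kos V d'.+1 j'.+2
    else fun a : V => (if i == d' then (0, a) else (@hot d' 0 a, 0)) : kos V d'.+1 1
  else fun=> 0.

Lemma hot_is_linear d j : linear (@hot d j).
Proof.
have e0 d' j' r : 0 = r *: 0 + 0 :> kos V d' j' by rewrite scaler0 addr0.
elim: d j => [|d IH] [|j] r a b; try exact: kos0; rewrite /hot -/hot; case: (i == d).
- by congr (_, _); apply: (e0 d 1%N).
- by congr (_, _); [apply: IH | apply: (e0 d 0%N)].
- by congr (_, _); apply: (e0 d j.+2).
- congr (_, _); first exact: IH.
  have e : - hot (r *: (a.2 : kos V d j) + b.2) =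
      r *: - hot (a.2 : kos V d j) - hot (b.2 : kos V d j).
    by rewrite IH opprD -scalerN.
  exact: e.
Qed.
HB.instance Definition _ d j :=
  GRing.isLinear.Build S (kos V d j) (kos V d j.+1) _ (@hot d j) (@hot_is_linear d j).

Lemma hot_homotopy (x : nat -> S) d : (i < d)%N ->
  (forall v : kos V d 0, dif x (hot v) = x i *: v) /\
  forall j (a : kos V d j.+1), dif x (hot a) + hot (dif x a) = x i *: a.
Proof.
elim: d => // d IH; rewrite ltnS leq_eqVlt; have [ei _|ne_id /= lt_id] := eqVneq i d.
  subst d; split=> [v|j [a b]].
    have e : dif x (0 : kos V i 1) + x i *: (v : kos V i 0) = x i *: v.
      by rewrite linear0 add0r.
    by rewrite /hot eqxx; apply: e.
  have e1 : dif x (0 : kos V i j.+2) + x i *: (a : kos V i j.+1) + 0 = x i *: (a : kos V i j.+1).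
    by rewrite linear0 add0r addr0.
  have e2 : - dif x (a : kos V i j.+1) + (dif x (a : kos V i j.+1) + x i *: (b : kos V i j)) =
      x i *: (b : kos V i j).
    by rewrite addKr.
  by case: j a b e1 e2 => [|j] a b e1 e2; rewrite /hot eqxx; congr (_, _).
have [IH0 IH1] := IH lt_id; split=> [v|j [a b]].
  have e : dif x (hot (v : kos V d 0)) + x d *: (0 : kos V d 0) = x i *: (v : kos V d 0).
    by rewrite IH0 scaler0 addr0.
  by rewrite /hot -/hot (negPf ne_id); apply: e.
have e1 : dif x (hot (a : kos V d j.+1)) + x d *: - hot (b : kos V d j) +
    hot (dif x (a : kos V d j.+1) + x d *: (b : kos V d j)) = x i *: (a : kos V d j.+1).
  by rewrite linearD linearZ /= scalerN addrACA addNr addr0 IH1.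
case: j a b e1 => [|j] a b e1.
  have e2 : - dif x (- hot (b : kos V d 0)) + 0 = x i *: (b : kos V d 0).
    by rewrite linearN opprK addr0; apply: IH0.
  by rewrite /dif -/dif /hot -/hot (negPf ne_id); congr (_, _).
have e2 : - dif x (- hot (b : kos V d j.+1)) + - hot (- dif x (b : kos V d j.+1)) =
    x i *: (b : kos V d j.+1).
  by rewrite !linearN /= !opprK; apply: IH1.
by rewrite /dif -/dif /hot -/hot (negPf ne_id); congr (_, _).
Qed.

Lemma cycle_smul (x : nat -> S) d j (a : kos V d j) : (i < d)%N -> cycle x a ->
  exists b : kos V d j.+1, dif x b = x i *: a.
Proof.
move=> lt_id; have [h0 h1] := hot_homotopy x lt_id.
case: j a => [|j] a ca; exists (hot a); first exact: h0.
by rewrite -h1 ca linear0 addr0.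
Qed.

End Homotopy.

Section DegreeZero.
Variables (S : comNzRingType) (V : lmodType S) (x : nat -> S).

Lemma dif0P d (v : V) : (exists b : kos V d 1, dif x b = v) <->
  exists c : nat -> V, v = \sum_(i < d) x i *: c i.
Proof.
split=> [[b <-]|[c ->]].
  elim: d b => [|d IH] b; first by exists (fun=> 0); rewrite big_ord0.
  case: b => b u; have [c ec] := IH b; exists (fun i => if i == d then u else c i).
  have e : dif x (b : kos V d 1) + x d *: u =
      \sum_(i < d.+1) x i *: (if i == d :> nat then u else c i).
    rewrite big_ord_recr /= eqxx ec; congr (_ + _).
    by apply: eq_bigr => i _; rewrite ltn_eqF.
  exact: e.
elim: d => [|d [b eb]]; first by exists 0; rewrite linear0 big_ord0.
by exists (b, c d); rewrite big_ord_recr /= -eb.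
Qed.
End DegreeZero.

Lemma dif0_combs (S : comNzRingType) (x : nat -> S) d (s : S) :
  (exists b : kos S^o d 1, dif x b = s) <-> combs d x s.
Proof.
split=> [/dif0P|] [c ->]; [|apply/dif0P]; exists c; apply: eq_bigr => i _; exact: mulrC.
Qed.

Section PerfectAcyclic.
Variables (S : comNzRingType) (x z : nat -> nat -> S).
Hypothesis xz : forall e i, x e i = z e i * x e.+1 i.
Hypothesis colon : forall e d v, combs d (x e) (x e d * v) -> combs d (x e.+1) (z e d * v).

Let taus_fst (V : lmodType S) d j e k (a : kos V d.+1 j.+1) :
  (taus z e k a).1 = taus z e k (a.1 : kos V d j.+1) :> kos V d j.+1.
Proof. by elim: k => //= k <-; case: j a. Qed.

Let taus_snd (V : lmodType S) d j e k (a : kos V d.+1 j.+1) : exists r,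
  (taus z e k a).2 = r *: taus z e k (a.2 : kos V d j) :> kos V d j.
Proof.
elim: k => [|k [r er]]; first by exists 1; rewrite scale1r.
exists (z (e + k)%N d * r).
have -> : (z (e + k)%N d * r) *: taus z e k.+1 (a.2 : kos V d j) =
    z (e + k)%N d *: tau (z (e + k)%N) (r *: taus z e k (a.2 : kos V d j)).
  by rewrite linearZ scalerA.
by rewrite -er; case: j a {er}.
Qed.

(** The e_d-component of a cycle dies: in positive degree by induction, and in degree 0 because it
    is some v with x_d v in the ideal of the earlier elements, and the transition map multiplies it
    by the very z_d that [colon] provides. *)
Lemma acyclic_perfect d j : acyclic x z S^o d j.+1.
Proof.
elim: d j => [|d IH] j e a ca; first by exists 0%N, 0; apply: kos0.
have [k [b eb]] : exists k (b : kos S^o d j.+1),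
    dif (x (e + k)) b = (taus z e k a).2 :> kos S^o d j.
  case: j IH a ca => [|j] IH a ca.
    have [|b eb] := (dif0_combs (x e.+1) d (z e d * (a.2 : S))).2.
      apply: colon; apply/dif0_combs; exists (- a.1); rewrite linearN /=.
      have /eqP : dif (x e) (a.1 : kos S^o d 1) + x e d *: (a.2 : S^o) = 0 := ca.
      by rewrite addr_eq0 => /eqP->; rewrite opprK.
    by exists 1%N, b; rewrite addn1 eb /= addn0.
  have ca2 : - dif (x e) (a.2 : kos S^o d j.+1) = 0 := congr1 snd ca.
  have [|k [b eb]] := IH j e a.2; first by apply: oppr_inj; rewrite oppr0.
  by have [r er] := taus_snd e k a; exists k, (r *: b); rewrite linearZ /= eb er.
apply: (@dies_taus _ x z _ _ _ _ k).
have := cycle_taus xz k ca; move: (taus z e k a) eb => {ca} [a0 a1] eb ca.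
have ca0 : cycle (x (e + k)) ((a0 : kos S^o d j.+1) + x (e + k) d *: (b : kos S^o d j.+1)).
  rewrite /cycle linearD linearZ /= eb.
  by case: j {IH} a a0 a1 b eb ca => [|j] a a0 a1 b eb ca; [apply: ca | apply: (congr1 fst ca)].
have [l [c ec]] := IH j (e + k)%N _ ca0.
(* Adding d(e_d b) removes the e_d-component; what is left is a cycle on d elements, bounded by [c]
   at a later stage. *)
exists l, (((c, 0) : kos S^o d.+1 j.+2) - taus z (e + k) l ((0, b) : kos S^o d.+1 j.+2)).
rewrite linearB /= -taus_dif //; apply/eqP; rewrite subr_eq; apply/eqP.
apply: etrans _ (linearD (@taus _ z S^o d.+1 j.+1 (e + k) l) (a0, a1)
  (dif (x (e + k)%N) ((0, b) : kos S^o d.+1 j.+2))).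
have -> : ((a0, a1) : kos S^o d.+1 j.+1) + dif (x (e + k)%N) ((0, b) : kos S^o d.+1 j.+2) =
    (a0 + x (e + k)%N d *: (b : kos S^o d j.+1), 0).
  have e1 : (a0 : kos S^o d j.+1) + (dif (x (e + k)%N) (0 : kos S^o d j.+2) +
      x (e + k)%N d *: (b : kos S^o d j.+1)) = a0 + x (e + k)%N d *: (b : kos S^o d j.+1).
    by rewrite linear0 add0r.
  have e2 : a1 - dif (x (e + k)%N) b = 0 :> kos S^o d j by rewrite eb subrr.
  by congr (_, _).
set u := (_, 0) : kos S^o d.+1 j.+1.
have e1 : dif (x (e + k + l)%N) c + x (e + k + l)%N d *: (0 : kos S^o d j.+1) =
    (taus z (e + k) l u).1 :> kos S^o d j.+1.
  by rewrite scaler0 addr0 ec taus_fst.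
have e2 : - dif (x (e + k + l)%N) (0 : kos S^o d j.+1) =
    (taus z (e + k) l u).2 :> kos S^o d j.
  have [r ->] := taus_snd (e + k) l u.
  have -> : taus z (e + k) l (u.2 : kos S^o d j) = 0 by apply: linear0.
  by rewrite scaler0 linear0 oppr0.
rewrite [RHS]surjective_pairing; congr (_, _); [exact: e1 | exact: e2].
Qed.
End PerfectAcyclic.

(** * Coherence *)

Section SubmoduleType.
Variables (S : comNzRingType) (V : lmodType S) (N : set V).
Hypothesis sN : is_submodule N.

(** The proof is an argument so that the closure instance, and with it the module structure, can be
    inferred. *)
Definition submod_pred (_ : is_submodule N) : {pred V} := [pred v | `[< N v >]].

Lemma submod_pred_closed : submod_closed (submod_pred sN).
Proof.
split=> [|a u v]; first by apply/asboolP; apply: submod0.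
move=> /asboolP Nu /asboolP Nv; apply/asboolP.
by apply: submodD => //; apply: submodZ.
Qed.
HB.instance Definition _ := GRing.isSubmodClosed.Build S V (submod_pred sN) submod_pred_closed.

Record submod_type := SubmodType { submod_val : V; _ : submod_val \in submod_pred sN }.
HB.instance Definition _ := [isSub for submod_val].
HB.instance Definition _ := [Choice of submod_type by <:].
HB.instance Definition _ := [SubChoice_isSubLmodule of submod_type by <:].

Lemma submodule_lmod : exists (A : lmodType S) (i : {linear A -> V}),
  injective i /\ range i = N.
Proof.
exists submod_type, (val : {linear submod_type -> V}); split; first exact: val_inj.
apply/predeqP => v; split=> [[u _ <-]|Nv]; first exact/asboolP/(valP u).
have vN : v \in submod_pred sN by apply/asboolP.
by exists (Sub v vN) => //; rewrite SubK.
Qed.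
End SubmoduleType.

Section Coherence.
Variable S : comNzRingType.
Implicit Types (U V W : lmodType S).

Lemma ker_submodule V W (f : {linear V -> W}) : is_submodule (f @^-1` [set 0]).
Proof.
split=> [|u v /= fu fv|a u /= fu] /=; first exact: linear0.
  by rewrite linearD fu fv addr0.
by rewrite linearZ_LR fu scaler0.
Qed.

Lemma lift_rV n V W (f : {linear 'rV[S]_n -> W}) (g : {linear V -> W}) :
  range f `<=` range g -> exists h : {linear 'rV[S]_n -> V}, forall v, g (h v) = f v.
Proof.
move=> fg; have /choice[e he] : forall i : 'I_n, exists e, g e = f (delta_mx 0 i).
  by move=> i; have [|e _ <-] := fg (f (delta_mx 0 i)); [exists (delta_mx 0 i) | exists e].
exists (rowcomb e) => v; rewrite {2}[v]row_sum_delta !linear_sum.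
by apply: eq_bigr => i _; rewrite !linearZ he.
Qed.

(* Every finitely generated submodule is finitely presented. *)
Definition pseudo_coherent V :=
  forall n (f : {linear 'rV[S]_n -> V}), finitely_generated (f @^-1` [set 0]).

Lemma fg_surj V (N : set V) (A : lmodType S) (i : {linear A -> V}) :
  injective i -> range i = N -> finitely_generated N ->
  exists n (f : {linear 'rV[S]_n -> A}), forall a, exists v, f v = a.
Proof.
move=> iinj iN [n [phi phiN]]; have [|h hP] := @lift_rV n A V phi i.
  by rewrite phiN iN.
exists n, h => a; have : range phi (i a) by rewrite phiN -iN; exists a.
by move=> [v _ ev]; exists v; apply: iinj; rewrite hP.
Qed.

(** Finite presentation is given for one free cover and wanted for all. With lifts a and b between
    two covers, a relation v is (v - b (a v)) + b (a v), and a v is a relation of the other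
    cover. *)
Lemma coherent_ring : coherent S -> pseudo_coherent S^o.
Proof.
move=> cohS n f; have [||m [n' [psi [phi [psiP phiP]]]]] := cohS (range f).
- exact: range_submodule.
- by exists n, f.
have [|a ha] := @lift_rV _ _ _ f phi; first by rewrite phiP.
have [|b hb] := @lift_rV _ _ _ phi f; first by rewrite phiP.
apply: (@generates_fg _ _ ([seq b (psi (delta_mx 0 i)) | i <- enum 'I_m] ++
   [seq delta_mx 0 i - b (a (delta_mx 0 i)) | i <- enum 'I_n])).
  exact: ker_submodule.
split=> [g|K sK Kg v fv0].
  rewrite mem_cat => /orP[] /mapP[i _ ->] /=; last by rewrite linearB /= hb ha subrr.
  rewrite hb; have : range psi (psi (delta_mx 0 i)) by exists (delta_mx 0 i).
  by rewrite psiP.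
have -> : v = (v - b (a v)) + b (a v) by rewrite subrK.
apply: submodD => //.
  rewrite {1 2}[v]row_sum_delta (linear_sum a) (linear_sum b) -sumrB; apply: submod_sum => // i _.
  rewrite !linearZ /= -scalerDr; apply: submodZ => //; apply: Kg.
  by rewrite mem_cat orbC; apply/orP; left; apply/mapP; exists i; rewrite ?mem_enum.
have : range psi (a v) by rewrite psiP /= ha.
move=> [u _ <-]; rewrite [u]row_sum_delta !linear_sum; apply: submod_sum => // i _.
rewrite !linearZ; apply: submodZ => //; apply: Kg.
by rewrite mem_cat; apply/orP; left; apply/mapP; exists i; rewrite ?mem_enum.
Qed.

(** Cover the kernel of f h by a finite free module, then the kernel of g h on that module. *)
Lemma pseudo_coherent_joint V W1 W2 (f : {linear V -> W1}) (g : {linear V -> W2}) :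
  (forall v, f v = 0 -> g v = 0 -> v = 0) ->
  pseudo_coherent W1 -> pseudo_coherent W2 -> pseudo_coherent V.
Proof.
move=> fg0 cf cg n h.
have [k [u uP]] := cf n (f \o h : {linear _ -> _}).
have [l [w wP]] := cg k (g \o (h \o u) : {linear _ -> _}).
exists l, (u \o w : {linear _ -> _}); apply/predeqP => v; split=> [[t _ <-] /=|hv].
  apply: fg0.
    have : range u (u (w t)) by exists (w t).
    by rewrite uP.
  have : range w (w t) by exists t.
  by rewrite wP.
have : range u v by rewrite uP /= hv linear0.
move=> [t _ et]; have : range w t by rewrite wP /= et hv linear0.
by move=> [s _ es]; exists s => //=; rewrite es.
Qed.

Lemma pseudo_coherent_sub V W (f : {linear V -> W}) :
  injective f -> pseudo_coherent W -> pseudo_coherent V.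
Proof.
move=> finj cW; apply: (pseudo_coherent_joint (f := f) (g := f)) => // v fv _.
by apply: finj; rewrite fv linear0.
Qed.

Lemma pseudo_coherent_rV0 : pseudo_coherent 'rV[S]_0.
Proof.
move=> n f; exists n, (idfun : {linear 'rV[S]_n -> 'rV[S]_n}).
by apply/predeqP => v; split=> _; [apply: thinmx0 | exists v].
Qed.

Lemma pseudo_coherent_rV n : coherent S -> pseudo_coherent 'rV[S]_n.
Proof.
move=> cohS; elim: n => [|n IH]; first exact: pseudo_coherent_rV0.
have lin0 : linear (fun v : 'rV[S]_n.+1 => v 0 0 : S^o) by move=> a u v; rewrite !mxE.
pose c0 : {linear _ -> _} := HB.pack (fun v : 'rV[S]_n.+1 => v 0 0 : S^o)
  (GRing.isLinear.Build _ _ _ _ _ lin0).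
have lin1 : linear (fun v : 'rV[S]_n.+1 => \row_i v 0 (lift 0 i)).
  by move=> a u v; apply/rowP => i; rewrite !mxE.
pose c1 : {linear _ -> _} := HB.pack (fun v : 'rV[S]_n.+1 => \row_i v 0 (lift 0 i))
  (GRing.isLinear.Build _ _ _ _ _ lin1).
apply: (pseudo_coherent_joint (f := c0) (g := c1)) => //; last exact: coherent_ring.
move=> v v0 v1; apply/rowP => i; rewrite [RHS]mxE.
have [j ->|->] := unliftP 0 i; last exact: v0.
by have := congr1 (fun w : 'rV_n => w 0 j) v1; rewrite !mxE.
Qed.

Lemma pseudo_coherent_kos d j : coherent S -> pseudo_coherent (kos S^o d j).
Proof.
move=> cohS; case: j => [|j]; first exact: coherent_ring.
elim: d j => [|d IH] j; first exact: pseudo_coherent_rV0.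
have cj : pseudo_coherent (kos S^o d j) by case: j => [|j]; [exact: coherent_ring | exact: IH].
apply: (pseudo_coherent_joint (V := prodM (kos S^o d j.+1) (kos S^o d j))
  (f := fst) (g := snd)) (IH j) cj.
by move=> [u v] /= -> ->.
Qed.

Lemma fg_kos d j : exists gs, generates gs [set: kos S^o d j].
Proof.
have fgS : exists gs, generates gs [set: S^o].
  exists [:: 1]; split=> // K sK K1 v _; rewrite -[v]mulr1.
  by apply: (@submodZ S S^o K v 1) => //; apply: K1; rewrite inE.
case: j => [|j] //; elim: d j => [|d IH] j.
  by exists [::]; split=> // K sK _ v _; rewrite [v]thinmx0; apply: submod0.
have [gs1 [_ gen1]] := IH j.
have [gs2 [_ gen2]] : exists gs, generates gs [set: kos S^o d j].
  by case: j {gs1 gen1} => [|j]; [exact: fgS | exact: IH].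
pose W := prodM (kos S^o d j.+1) (kos S^o d j).
exists ([seq ((g, 0) : W) | g <- gs1] ++ [seq ((0, g) : W) | g <- gs2]).
split=> // K sK Kgs [u v] _.
have -> : (u, v) = ((u, 0) : W) + ((0, v) : W).
  by congr (_, _); rewrite ?addr0 ?add0r.
apply: (submodD (V := W)) => //.
  apply: (gen1 (fun u => K ((u, 0) : W))) => // [|g gs1g].
    split=> [|u1 u2 h1 h2|a u1 h1]; first exact: (submod0 (V := W)).
      by have := submodD (V := W) sK h1 h2; congr (K (_, _)); rewrite addr0.
    by have := submodZ (V := W) a sK h1; congr (K (_, _)); rewrite scaler0.
  by apply: Kgs; rewrite mem_cat; apply/orP; left; apply/mapP; exists g.
apply: (gen2 (fun u => K ((0, u) : W))) => // [|g gs2g].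
  split=> [|u1 u2 h1 h2|a u1 h1]; first exact: (submod0 (V := W)).
    by have := submodD (V := W) sK h1 h2; congr (K (_, _)); rewrite addr0.
  by have := submodZ (V := W) a sK h1; congr (K (_, _)); rewrite scaler0.
by apply: Kgs; rewrite mem_cat; apply/orP; right; apply/mapP; exists g.
Qed.

Lemma fg_ker V W (f : {linear V -> W}) gs : generates gs [set: V] ->
  pseudo_coherent W -> finitely_generated (f @^-1` [set 0]).
Proof.
move=> gen cW; have [//|n [phi phiV]] := @generates_fg S V gs setT _ gen.
have [k [u uP]] := cW n (f \o phi : {linear _ -> _}).
exists k, (phi \o u : {linear _ -> _}); apply/predeqP => v; split=> [[t _ <-] /=|fv].
  have : range u (u t) by exists t.
  by rewrite uP.
have : range phi v by rewrite phiV.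
move=> [w _ ew]; have : range u w by rewrite uP /= ew.
by move=> [t _ et]; exists t => //=; rewrite et.
Qed.
End Coherence.

Section Nakayama.
Variables (S : comNzRingType) (n : set S) (V : lmodType S).
Hypotheses (idn : is_ideal n) (n_unit : forall s, ~ n s -> exists t, t * s = 1) (n1 : ~ n 1).
Implicit Types (B N : set V) (gs : seq V).

(* B + n gs *)
Fixpoint nspan B gs : set V :=
  if gs is g :: gs' then [set v | exists2 a, n a & nspan B gs' (v - a *: g)] else B.

Lemma nspan_submodule B gs : is_submodule B -> is_submodule (nspan B gs).
Proof.
move=> sB; elim: gs => //= g gs IH; split=> [|u v [a na hu] [b nb hv]|a u [b nb hu]].
- by exists 0; [exact: ideal0 | rewrite scale0r subr0; apply: submod0].
- exists (a + b); first exact: idealD.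
  by rewrite scalerDl opprD addrACA; apply: submodD.
- exists (a * b); first exact: idealMl.
  by rewrite -scalerA -scalerBr; apply: submodZ.
Qed.

Lemma nspan_sub B gs : B `<=` nspan B gs.
Proof.
elim: gs => //= g gs IH v Bv; exists 0; first exact: ideal0.
by rewrite scale0r subr0; apply: IH.
Qed.

Lemma nspan_mem B gs a g : is_submodule B -> n a -> g \in gs -> nspan B gs (a *: g).
Proof.
move=> sB na; elim: gs => //= h gs IH; rewrite inE => /orP[/eqP->|/IH hg].
  by exists a; rewrite // subrr; apply: submod0 (nspan_submodule gs sB).
by exists 0; [exact: ideal0 | rewrite scale0r subr0].
Qed.

Lemma n_sub1_unit a : n a -> exists t, t * (1 - a) = 1.
Proof.
by move=> na; apply: n_unit => n1a; apply: n1; rewrite -(subrK a 1); apply: idealD.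
Qed.

(** Since 1 - a is a unit for a in n, the expression of g can be solved for g and substituted in the
    others, which shortens the list. *)
Lemma nspan_nakayama B gs : is_submodule B ->
  (forall g, g \in gs -> nspan B gs g) -> forall g, g \in gs -> B g.
Proof.
move=> sB; elim: gs => //= g gs IH hgs.
have sN := nspan_submodule gs sB.
have hg : nspan B gs g.
  have [a na ha] := hgs g (mem_head _ _); have [t et] := n_sub1_unit na.
  rewrite -[g]scale1r -et -scalerA; apply: submodZ => //.
  by rewrite scalerBl scale1r.
have Bgs : forall h, h \in gs -> B h.
  apply: IH => h hh; have [|a na ha] := hgs h; first by rewrite inE hh orbT.
  by rewrite -(subrK (a *: g) h); apply: submodD => //; apply: submodZ.
have Bg : B g.
  elim: gs Bgs hg {IH hgs sN} => //= h gs IH Bgs [a na hg].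
  apply: IH => [k hk|]; first by apply: Bgs; rewrite inE hk orbT.
  rewrite -(subrK (a *: h) g); apply: submodD (nspan_submodule gs sB) hg _.
  by apply: nspan_sub; apply: submodZ => //; apply: Bgs; rewrite mem_head.
by move=> h; rewrite inE => /orP[/eqP->|/Bgs].
Qed.

Theorem nakayama B N : is_submodule B -> finitely_generated N ->
  (forall v, N v -> exists d (y : nat -> S) (c : nat -> V),
     [/\ forall i, (i < d)%N -> n (y i), forall i, (i < d)%N -> N (c i)
       & B (v - \sum_(i < d) y i *: c i)]) ->
  N `<=` B.
Proof.
move=> sB /fg_generates[gs [gN genN]] hN; apply: (genN B) => //.
apply: nspan_nakayama => // g /gN /hN[d [y [c [ny Nc Bg]]]].
have sN := nspan_submodule gs sB.
rewrite -(subrK (\sum_(i < d) y i *: c i) g); apply: submodD => //.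
  exact: nspan_sub.
apply: submod_sum => // i _.
apply: (genN (fun v => nspan B gs (y i *: v))); last exact: Nc.
  split=> [|u v hu hv|a u hu]; rewrite ?scaler0 ?scalerDr; first exact: submod0.
    exact: submodD.
  by rewrite scalerA mulrC -scalerA; apply: submodZ.
by move=> h hh; apply: nspan_mem => //; apply: ny.
Qed.
End Nakayama.

(** For one y_i after the other, multiply by its last power that stays outside B. *)
Lemma socle_element (S : comNzRingType) (V : lmodType S) (B : set V) (y : nat -> S) d w :
  is_submodule B -> ~ B w -> (forall i, (i < d)%N -> exists k, B (y i ^+ k *: w)) ->
  exists s, ~ B (s *: w) /\ forall i, (i < d)%N -> B ((y i * s) *: w).
Proof.
move=> sB nBw; elim: d => [|d IH] hy; first by exists 1; rewrite scale1r.
have [|s [nBs hs]] := IH; first by move=> i lt_i; apply: hy; apply: ltnW.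
have [k hk] := hy d (ltnSn d).
have exk : exists k, `[< B ((y d ^+ k * s) *: w) >].
  by exists k; apply/asboolP; rewrite mulrC -scalerA; apply: submodZ.
case: (ex_minnP exk) => -[/asboolP|{hk}k /asboolP hk kmin]; first by rewrite expr0 mul1r.
exists (y d ^+ k * s); split=> [h|i].
  by have : (k < k)%N; [apply: kmin; apply/asboolP | rewrite ltnn].
rewrite ltnS leq_eqVlt => /orP[/eqP->|lt_i]; first by rewrite mulrA -exprS.
by rewrite mulrCA -scalerA; apply: submodZ => //; apply: hs.
Qed.

(** * Acyclicity of the Koszul complex *)

Section KoszulExtras.
Variable S : comNzRingType.
Implicit Types (V W : lmodType S).

Definition smul_by V (v : V) (s : S^o) : V := s *: v.
Lemma smul_by_is_linear V (v : V) : linear (smul_by v).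
Proof. by move=> a s t; rewrite /smul_by scalerDl scalerA. Qed.
HB.instance Definition _ V (v : V) :=
  GRing.isLinear.Build S S^o V _ (smul_by v) (smul_by_is_linear v).

Lemma kmap_scale V r d j (a : kos V d j) : kmap (fun v : V => r *: v) a = r *: a.
Proof.
case: j a => // j; elim: d j => [|d IH] [|j] a; try exact: kos0.
  by case: a => a b; congr (_, _); apply: (IH 0%N).
by case: a => a b; congr (_, _); [apply: (IH j.+1) | apply: (IH j)].
Qed.

Fixpoint topcoef V d : kos V d d -> V :=
  if d is d'.+1 then fun a : kos V d'.+1 d'.+1 => @topcoef V d' a.2 else id.

Fixpoint topel d : kos S^o d d :=
  if d is d'.+1 then ((0, topel d') : kos S^o d'.+1 d'.+1) else (1 : S^o).

Lemma topcoef_el d : topcoef (topel d) = 1.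
Proof. by elim: d => //= d <-; case: d. Qed.

Lemma topcoef_kmap V W (f : V -> W) d (a : kos V d d) :
  topcoef (kmap f a) = f (topcoef a).
Proof. by elim: d a => //= d IH a; rewrite -IH; case: d a {IH}. Qed.

Lemma topcoef_scale V d r (a : kos V d d) : topcoef (r *: a) = r *: topcoef a.
Proof. by elim: d a => //= d IH a; rewrite -IH; case: d a {IH}. Qed.

Lemma topcoef_tau V z d (a : kos V d d) :
  topcoef (tau z a) = (\prod_(i < d) z i) *: topcoef a.
Proof.
elim: d a => [|d IH] a; first by rewrite big_ord0 scale1r.
transitivity (z d *: topcoef (tau z (a.2 : kos V d d))).
  by rewrite -topcoef_scale; case: d a {IH}.
by rewrite IH scalerA big_ord_recr /= mulrC.
Qed.

Lemma topcoef_taus V z d e k (a : kos V d d) :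
  topcoef (taus z e k a) = (\prod_(l < k) \prod_(i < d) z (e + l)%N i) *: topcoef a.
Proof.
elim: k => [|k IH]; first by rewrite big_ord0 scale1r.
by rewrite /= topcoef_tau IH scalerA big_ord_recr mulrC.
Qed.

(** Boundaries have coefficients in the ideal of the x_i, hence lift along a map whose image
    contains the x_i. *)
Lemma dif_range (A : lmodType S) (f : {linear A -> S^o}) x d j (b : kos S^o d j.+1) :
  (forall i, (i < d)%N -> exists a, f a = x i) ->
  exists a : kos A d j, kmap f a = dif x b.
Proof.
elim: d j b => [|d IH] j b fx; first by exists 0; rewrite linear0.
have {}IH k (c : kos S^o d k.+1) : exists a : kos A d k, kmap f a = dif x c.
  by apply: IH => i lt_i; apply: fx; apply: ltnW.
have [a0 fa0] := fx d (ltnSn d).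
case: b => b1 b2.
have [a1 e1] : exists a1 : kos A d j, kmap f a1 =
    dif x (b1 : kos S^o d j.+1) + x d *: (b2 : kos S^o d j).
  have [a1 e1] := IH j b1; exists (a1 + kmap (smul_by a0) (b2 : kos S^o d j)).
  rewrite linearD /= e1; congr (_ + _).
  rewrite (@kmap_comp _ S^o A S^o (smul_by a0) f (fun s => x d *: s)) ?kmap_scale // => s.
  by rewrite /smul_by linearZ_LR /= fa0 [LHS]mulrC.
case: j b1 b2 a1 e1 => [|j] b1 b2 a1 e1; first by exists a1.
have [a2 e2] := IH j (- (b2 : kos S^o d j.+1)).
exists (a1, a2); move: e2; rewrite linearN => e2.
case: j {IH} b1 b2 a1 a2 e1 e2 => [|j] b1 b2 a1 a2 e1 e2.
  exact: (congr2 (fun u v => (u, v) : kos S^o d.+1 1) e1 e2).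
exact: (congr2 (fun u v => (u, v) : kos S^o d.+1 j.+2) e1 e2).
Qed.

Lemma taus_const V d j e k (a : kos V d j) : taus (fun _ _ => 1) e k a = a.
Proof. by elim: k => //= k ->; apply: tau1. Qed.

Lemma taus_degree0 V z d e k (a : kos V d 0) : taus z e k a = a.
Proof. by elim: k. Qed.

(** The constant system computes ordinary Koszul homology, so one set of long exact sequences serves
    both systems. *)
Lemma dies_const V (x : nat -> S) d j e (a : kos V d j) :
  dies (fun=> x) (fun _ _ => 1) e a <-> range (@dif S V x d j) a.
Proof.
split=> [[k [b eb]]|[b _ eb]]; first by exists b; rewrite ?eb ?taus_const.
by exists 0%N, b.
Qed.

Lemma free_coord_lin n (i : 'I_n) : linear (fun v : 'rV[S]_n => v 0 i : S^o).
Proof. by move=> a u v; rewrite !mxE. Qed.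

End KoszulExtras.

(** The boundary of the top basis element lifts to A. If this lift died, the transported basis
    element would differ from an element of the complex of A by a top-degree cycle, which becomes
    zero at a later stage; its coefficient, a product of the z, would then lie in the ideal. *)
Lemma not_hinj_parameters (S : comNzRingType) (x z : nat -> nat -> S) k
    (A : lmodType S) (i : {linear A -> S^o}) :
  (forall e j, x e j = z e j * x e.+1 j) ->
  (forall e d v, combs d (x e) (x e d * v) -> combs d (x e.+1) (z e d * v)) ->
  (forall m, ~ combs k.+1 (x 0%N) (\prod_(l < m) \prod_(j < k.+1) z l j)) ->
  range i = combs k.+1 (x 0%N) -> ~ hinj x z i k.+1 k.
Proof.
move=> xz colon monomial iA hi.
have [|a ea] := @dif_range S A i (x 0%N) k.+1 k (topel S k.+1).
  move=> l lt_l; have : range i (x 0%N l) by rewrite iA; apply: mem_combs.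
  by move=> [a _ <-]; exists a.
have [l [b eb]] := hi 0%N a _ ea; rewrite add0n in eb.
have cyc : dif (x l) (kmap i b - taus z 0 l (topel S k.+1)) = 0.
  have := taus_dif xz 0 l (topel S k.+1); rewrite add0n => td.
  have td' : taus z 0 l (kmap i a) = dif (x l) (taus z 0 l (topel S k.+1)).
    by rewrite -td; congr taus.
  by rewrite linearB /= -td' -taus_kmap -eb kmap_dif subrr.
have [m [b' eb']] := @acyclic_perfect S x z xz colon k.+1 k l _ cyc.
have eb2 : taus z 0 (l + m) (topel S k.+1) = kmap i (taus z l m b).
  apply/esym/eqP; rewrite -subr_eq0; apply/eqP.
  transitivity (taus z l m (kmap i b - taus z 0 l (topel S k.+1))).
    by rewrite linearB /= taus_kmap tausD add0n.
  by rewrite -eb' [b']kos_top // linear0.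
have := congr1 (@topcoef S S^o k.+1) eb2.
rewrite topcoef_taus topcoef_el topcoef_kmap => e3; apply: (monomial (l + m)%N).
rewrite -iA; exists (topcoef (taus z l m b)) => //.
by rewrite -e3 [LHS]mulr1; apply: eq_bigr => q _; apply: eq_bigr => q' _; rewrite add0n.
Qed.

Section Acyclicity.
Variables (S : comNzRingType) (n : set S) (d : nat) (x z : nat -> nat -> S).
Hypothesis cohS : coherent S.
Hypotheses (idn : is_ideal n) (n1 : ~ n 1).
Hypothesis n_unit : forall s, ~ n s -> exists t, t * s = 1.
Hypothesis xz : forall e i, x e i = z e i * x e.+1 i.
Hypothesis colon :
  forall e d' v, combs d' (x e) (x e d' * v) -> combs d' (x e.+1) (z e d' * v).
Hypothesis nx : forall e i, (i < d)%N -> n (x e i).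
Hypothesis n_combs : forall s, n s -> exists e, combs d (x e) s.
Hypothesis n_pow : forall s, n s -> exists k, combs d (x 0%N) (s ^+ k).

Local Notation x0 := (fun=> x 0%N).
Local Notation z1 := (fun _ _ => 1).

Let x0z1 : forall e i : nat, x 0%N i = 1 * x 0%N i.
Proof. by move=> e i; rewrite mul1r. Qed.

Let combs_le e k : combs d (x e) `<=` combs d (x (e + k)%N).
Proof.
elim: k => [|k IH]; rewrite ?addn0 //; apply: subset_trans IH _.
rewrite addnS; apply: combs_sub => [|i lt_i]; first exact: ideal_combs.
by rewrite xz; apply: idealMl (ideal_combs _ _) _; apply: mem_combs.
Qed.

Lemma minimal_surj (A : lmodType S) :
  (exists k (f : {linear 'rV[S]_k -> A}), forall a, exists v, f v = a) ->
  exists k (f : {linear 'rV[S]_k -> A}), (forall a, exists v, f v = a) /\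
    forall v, f v = 0 -> forall i, n (v 0 i).
Proof.
move=> [k]; elim: k => [|k IH] [f fsurj]; first by exists 0%N, f; split=> // v _ [].
have [min|] := pselect (forall v, f v = 0 -> forall i, n (v 0 i)).
  by exists k.+1, f.
move=> /existsNP[v /not_implyP[fv0 /existsNP[i nvi]]]; apply: IH.
have [t et] := n_unit nvi.
exists (rowcomb (fun j => f (delta_mx 0 (lift i j)))) => a.
have [w <-] := fsurj a; pose u := w - (w 0 i * t) *: v.
have fu : f u = f w by rewrite linearB linearZ_LR /= fv0 scaler0 subr0.
have ui : u 0 i = 0 by rewrite !mxE -mulrA et mulr1 subrr.
exists (\row_j u 0 (lift i j)); rewrite -fu [u in RHS]row_sum_delta linear_sum.
rewrite (bigD1_ord i) //= ui scale0r linear0 add0r.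
by apply: eq_bigr => j _; rewrite mxE linearZ.
Qed.

(** As T_1(A) = 0, T_0 of the kernel L injects into T_0 of the free module. Its image is zero by
    minimality, so L = n L, and Nakayama applies. *)
Lemma free_of_acyclic (A : lmodType S) k (f : {linear 'rV[S]_k -> A}) :
  (forall a, exists v, f v = a) -> (forall v, f v = 0 -> forall i, n (v 0 i)) ->
  pseudo_coherent A -> acyclic x z A d 1 -> injective f.
Proof.
move=> fsurj fmin cA acA.
have fgK := cA k f; have sK := ker_submodule f.
have [L [i [iinj iL]]] := submodule_lmod sK.
have fi a : f (i a) = 0 by have : range i (i a); [exists a | rewrite iL].
have if_ v : f v = 0 -> exists a, i a = v.
  by move=> fv; have : range i v; [rewrite iL | move=> [a _ <-]; exists a].
have hi : hinj x z i d 0 := hinj_of_acyclic xz iinj fsurj fi if_ acA.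
suff K0 : f @^-1` [set 0] `<=` [set 0].
  move=> u v fuv; apply/eqP; rewrite -subr_eq0; apply/eqP; apply: K0 => /=.
  by rewrite linearB /= fuv subrr.
apply: (nakayama idn n_unit n1 _ fgK).
  by split=> // [u v -> ->|a u ->]; rewrite ?addr0 ?scaler0.
move=> v fv; have [a ea] := if_ v fv.
have [e ve] : exists e, forall j, combs d (x e) (v 0 j).
  have /choice[es hes] : forall j, exists e, combs d (x e) (v 0 j).
    by move=> j; apply: n_combs; apply: fmin.
  exists (\sum_j es j)%N => j; rewrite (bigD1 j) //=.
  exact: combs_le (hes j).
have [b eb] : exists b : kos 'rV[S]_k d 1, dif (x e) b = v.
  have /choice[c hc] : forall j, exists c : nat -> S, v 0 j = \sum_(l < d) c l * x e l.
    by move=> j; apply: ve.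
  apply/dif0P; exists (fun l => \row_j c j l); apply/rowP => j.
  rewrite hc summxE; apply: eq_bigr => l _.
  by rewrite !mxE mulrC.
have [|m [b' eb']] := hi e a b; first by rewrite eb -ea.
rewrite taus_degree0 in eb'.
have /dif0P[c ec] : exists b' : kos L d 1, dif (x (e + m)%N) b' = a by exists b'.
exists d, (x (e + m)%N), (fun l => i (c l)); split=> [l lt_l|l _|]; first exact: nx.
  exact: fi.
rewrite -ea ec linear_sum /=; apply/eqP; rewrite subr_eq0; apply/eqP.
by apply: eq_bigr => l _; rewrite linearZ.
Qed.

Section TopHomology.
Variable c : nat.
Hypothesis top_vanish : forall j, (c < j)%N -> acyclic x0 z1 S^o d j.+1.
Hypothesis top_nz : ~ acyclic x0 z1 S^o d c.+1.

(** The x_i kill Koszul homology and every element of n has a power in (x), so a nonzero class has a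
    nonzero multiple killed by the y_i. *)
Lemma koszul_socle (y : nat -> S) l : (forall i, (i < l)%N -> n (y i)) ->
  exists w : kos S^o d c.+1, ~ range (@dif S S^o (x 0%N) d c.+1) w /\
    forall i, (i < l)%N -> range (@dif S S^o (x 0%N) d c.+1) (y i *: w).
Proof.
move=> ny; move: top_nz; rewrite /acyclic => /existsNP[e0 /existsNP[w /not_implyP[cw ndw]]].
have nBw : ~ range (@dif S S^o (x 0%N) d c.+1) w by move=> Bw; apply: ndw; apply/dies_const.
pose B := range (@dif S S^o (x 0%N) d c.+1).
have sB : is_submodule B by exact: range_submodule.
have [|s [nBs hs]] := @socle_element S _ B y l w sB nBw.
  move=> i /ny/n_pow[k [a ea]]; exists k; rewrite ea scaler_suml; apply: submod_sum => // j _.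
  rewrite -scalerA; apply: submodZ => //.
  by have [b eb] := cycle_smul (ltn_ord j) cw; exists b.
by exists (s *: w); split=> // i lt_i; rewrite scalerA; apply: hs.
Qed.

(** Let i a be in (x_e) F. If a coordinate of a is a unit, take a nonzero class w killed by the
    x_(e,l): i a times w bounds, so by injectivity a times w bounds, and then so does w. Thus all
    coordinates of a lie in n, and a dies in T_0(A). *)
Lemma not_hinj_free (F A : lmodType S) k (f : {linear 'rV[S]_k -> A}) (i : {linear A -> F}) :
  (forall a, exists v, f v = a) -> injective f ->
  ~ hinj x z i d 0 -> ~ hinj x0 z1 i d c.+1.
Proof.
move=> fsurj finj nhi hi; apply: nhi => e a b eab.
have [v ev] := fsurj a.
have [nv|] := pselect (forall j, n (v 0 j)).
  have /choice[es hes] : forall j, exists e, combs d (x e) (v 0 j).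
    by move=> j; apply: n_combs.
  have ve j : combs d (x (e + \sum_j es j)%N) (v 0 j).
    by rewrite (bigD1 j) //= addnCA; apply: combs_le (hes j).
  exists (\sum_j es j)%N; rewrite taus_degree0; apply/dif0P.
  have /choice[g hg] : forall j, exists g : nat -> S,
      v 0 j = \sum_(l < d) g l * x (e + \sum_j es j)%N l.
    by move=> j; apply: ve.
  exists (fun l => f (\row_j g j l)); rewrite -ev.
  have -> : v = \sum_(l < d) x (e + \sum_j es j)%N l *: \row_j g j l.
    apply/rowP => j; rewrite hg summxE; apply: eq_bigr => l _.
    by rewrite !mxE mulrC.
  by rewrite linear_sum; apply: eq_bigr => l _; rewrite linearZ.
move=> /existsNP[j nvj]; have [t et] := n_unit nvj; exfalso.
have [w [nBw hw]] := koszul_socle (nx e).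
have sB V : is_submodule (range (@dif S V (x 0%N) d c.+1)) by exact: range_submodule.
have /dif0P[g eg] : exists b : kos F d 1, dif (x e) b = i a by exists b.
have [b' eb'] : range (@dif S F (x 0%N) d c.+1) (kmap i (kmap (smul_by a) w)).
  rewrite (@kmap_comp _ S^o A F (smul_by a) i (smul_by (i a))) => [|s]; last first.
    by rewrite /smul_by linearZ.
  rewrite -(@kmap_sum S S^o F _ (index_enum 'I_d) (fun l s => smul_by (g l) (x e l *: s))).
    apply: submod_sum => // l _; have [u _ eu] := hw l (ltn_ord l).
    exists (kmap (smul_by (g l)) u) => //.
    rewrite -kmap_dif eu -kmap_scale.
    by apply: kmap_comp => s.
  move=> s; rewrite /smul_by eg scaler_sumr; apply: eq_bigr => l _.
  by rewrite scalerA mulrC.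
move=> ebi; have /dies_const[a' _ ea'] := hi 0%N _ b' (esym ebi).
have [a3 ea3] := kmap_surj fsurj a'.
have ev' : dif (x 0%N) a3 = kmap (smul_by v) w.
  apply: (kmap_inj finj); rewrite kmap_dif ea3 ea' -ev.
  by apply/esym/kmap_comp => s; rewrite /smul_by linearZ.
pose cj : {linear 'rV[S]_k -> S^o} := HB.pack (fun v : 'rV[S]_k => v 0 j : S^o)
  (GRing.isLinear.Build _ _ _ _ _ (@free_coord_lin S k j)).
have e3 : dif (x 0%N) (kmap cj a3) = v 0 j *: w.
  rewrite -kmap_dif ev' -kmap_scale; apply: kmap_comp => s.
  by rewrite /smul_by /= !mxE mulrC.
apply: nBw; exists (t *: kmap cj a3) => //.
have -> : dif (x 0%N) (t *: kmap cj a3) = t *: dif (x 0%N) (kmap cj a3) by rewrite linearZ.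
by rewrite e3 scalerA et scale1r.
Qed.

(* Along a resolution of A by free modules F_l the failure of injectivity moves
   from degree k of the colimit to degree 0, where it is detected on a free
   syzygy, and from there back to degree c + 1 + k of the Koszul homology. *)
Lemma not_hinj_transfer k (F A : lmodType S) (i : {linear A -> F}) :
  (forall j, acyclic x z F d j.+1) -> (forall j, (c < j)%N -> acyclic x0 z1 F d j.+1) ->
  pseudo_coherent F -> injective i ->
  (exists l (f : {linear 'rV[S]_l -> A}), forall a, exists v, f v = a) ->
  acyclic x z A d k.+1 -> ~ hinj x z i d k -> ~ hinj x0 z1 i d (c.+1 + k).
Proof.
elim: k F A i => [|k IH] F A i acF acHF cF iinj fgA acA nhi.
  have [l [f [fsurj fmin]]] := minimal_surj fgA.
  have finj := free_of_acyclic fsurj fmin (pseudo_coherent_sub iinj cF) acA.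
  by rewrite addn0; apply: not_hinj_free nhi.
have [l [f fsurj]] := fgA; have cA := pseudo_coherent_sub iinj cF.
have fgK := cA l f; have sK := ker_submodule f.
have [L [i' [iinj' iL]]] := submodule_lmod sK.
have fi a : f (i' a) = 0 by have : range i' (i' a); [exists a | rewrite iL].
have if_ v : f v = 0 -> exists a, i' a = v.
  by move=> fv; have : range i' v; [rewrite iL | move=> [a _ <-]; exists a].
have acR j : acyclic x z 'rV[S]_l d j.+1.
  by apply: (acyclic_rV xz); apply: acyclic_perfect.
have acHR j : (c < j)%N -> acyclic x0 z1 'rV[S]_l d j.+1.
  by move=> lt_cj; apply: (acyclic_rV x0z1); apply: top_vanish.
have hk1 : hinj x z i' d k.+1 := hinj_of_acyclic xz iinj' fsurj fi if_ acA.
have acL : acyclic x z L d k.+1 := acyclic_sub_of_hinj (acR k) hk1.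
(* Otherwise T_(k+1)(A) would vanish and [i] would be injective in degree k + 1. *)
have nhk : ~ hinj x z i' d k.
  move=> hk; apply: nhi; apply: (hinj_of_acyclic_sub iinj).
  exact: (acyclic_of_hinj xz fsurj fi if_ (acR k) hk).
have nhH := IH _ _ i' acR acHR (pseudo_coherent_rV cohS) iinj' (fg_surj iinj' iL fgK) acL nhk.
(* The way back, in the constant system: F has no homology in this degree, so injectivity leaves
   none for A, and [i'] is injective one degree lower. *)
move=> hH; apply: nhH; rewrite addnS in hH.
apply: (hinj_of_acyclic x0z1 iinj' fsurj fi if_).
by apply: (acyclic_sub_of_hinj _ hH); apply: acHF; lia.
Qed.
End TopHomology.

Hypothesis monomial :
  forall k, ~ combs d (x 0%N) (\prod_(l < k) \prod_(i < d) z l i).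

Theorem koszul_acyclic j : acyclic x0 z1 S^o d j.+1.
Proof.
have [-> //|d_gt0] := posnP d; first by move=> e a _; exists 0%N, 0; apply: kos0.
apply: contrapT => nacj.
(* Here [c] is the top nonvanishing degree minus one. *)
have exc : exists c, `[< ~ acyclic x0 z1 S^o d c.+1 >] by exists j; apply/asboolP.
have ltcd c : `[< ~ acyclic x0 z1 S^o d c.+1 >] -> (c <= d)%N.
  move=> /asboolP nacc; rewrite leqNgt; apply/negP => lt_dc; apply: nacc => e a _.
  by exists 0%N, 0; rewrite linear0 [a]kos_top // ltnS ltnW.
case: (ex_maxnP exc ltcd) => c /asboolP nacc cmax.
have vanish l : (c < l)%N -> acyclic x0 z1 S^o d l.+1.
  by move=> lt_cl; apply: contrapT => /asboolP/cmax; rewrite leqNgt lt_cl.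
have sI : is_submodule (combs d (x 0%N) : set S^o) by exact: ideal_combs.
have [A [i [iinj iA]]] := submodule_lmod sI.
have fgA : exists l (f : {linear 'rV[S]_l -> A}), forall a, exists v, f v = a.
  apply: fg_surj iinj iA _.
  apply: (@generates_fg S S^o [seq x 0%N i | i <- iota 0 d]); first exact: ideal_combs.
  split=> [_ /mapP[l + ->]|K sK Kx v]; first by rewrite mem_iota; apply: mem_combs.
  apply: combs_sub => // l lt_l; apply: Kx; apply/mapP; exists l => //.
  by rewrite mem_iota.
have acS l : acyclic x z S^o d l.+1 by apply: acyclic_perfect.
have dE : d = d.-1.+1 by rewrite prednK.
have nhi : ~ hinj x z i d d.-1.
  move: iA monomial; rewrite dE => iA mon; exact: not_hinj_parameters mon iA.
have acA : acyclic x z A d d.-1.+1.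
  by apply: (acyclic_sub_of_hinj (f := i) (acS _)); apply: hinj_top => //; lia.
apply: (not_hinj_transfer vanish nacc acS vanish (coherent_ring cohS) iinj fgA acA nhi).
by apply: hinj_top => //; lia.
Qed.

End Acyclicity.

(** * The perfect closure *)

Section KoszulRegular.
Variables (S : comNzRingType) (n : set S) (y : nat -> S).
Hypothesis cohS : coherent S.
Hypotheses (idn : is_ideal n) (n1 : ~ n 1).
Hypothesis n_unit : forall s, ~ n s -> exists t, t * s = 1.

Definition koszul_exact d := forall j (a : kos S^o d j.+1),
  dif y a = 0 -> exists b : kos S^o d j.+2, dif y b = a.

(** A cycle a is also the cycle (a, 0) on one more element; bounding it writes a as a boundary plus
    y_d times a cycle. Cycles are finitely generated by coherence, so Nakayama applies. *)
Lemma koszul_exact_pred d : n (y d) -> koszul_exact d.+1 -> koszul_exact d.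
Proof.
move=> nyd ex j.
suff sub : (@dif S S^o y d j) @^-1` [set 0] `<=` range (@dif S S^o y d j.+1).
  by move=> a /sub[b _ eb]; exists b.
apply: (nakayama idn n_unit n1 (range_submodule _)).
  have [gs gen] := fg_kos S d j.+1.
  exact: (fg_ker (@dif S S^o y d j) gen (@pseudo_coherent_kos S d j cohS)).
move=> a ca.
have [|[a' b] eb] := ex j ((a, 0) : kos S^o d.+1 j.+1).
  have e1 : dif y (a : kos S^o d j.+1) + y d *: (0 : kos S^o d j) = 0.
    by rewrite scaler0 addr0.
  case: j {ex} a ca e1 => [|j] a ca e1; first exact: e1.
  have e2 : - dif y (0 : kos S^o d j.+1) = 0 by rewrite linear0 oppr0.
  exact: (congr2 (fun u v => (u, v) : kos S^o d.+1 j.+1) e1 e2).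
have eb1 : dif y (a' : kos S^o d j.+2) + y d *: (b : kos S^o d j.+1) = a := congr1 fst eb.
have eb2 : - dif y (b : kos S^o d j.+1) = 0 := congr1 snd eb.
exists 1%N, (fun=> y d), (fun=> b); split=> // [l _ /=|].
  by apply: oppr_inj; rewrite oppr0.
by rewrite big_ord1; exists a'; rewrite // -eb1 addrK.
Qed.

(** If y_i v = d a, then -a + e_i v is a cycle on i + 1 elements, and the e_i-component of a chain
    bounding it puts v into the ideal of the earlier elements. *)
Lemma koszul_exact_regular d i v : (forall k, (k < d)%N -> n (y k)) ->
  koszul_exact d -> (i < d)%N -> combs i y (y i * v) -> combs i y v.
Proof.
move=> ny ex lt_id /dif0_combs[a ea].
have {}ex : koszul_exact i.+1.
  rewrite -(subKn lt_id); elim: (d - i.+1)%N => [|k IH]; first by rewrite subn0.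
  have [le_dk|lt_kd] := leqP d k; first by have -> : (d - k.+1 = d - k)%N by lia.
  apply: koszul_exact_pred; first by apply: ny; lia.
  by have -> : ((d - k.+1).+1 = d - k)%N by lia.
have [|[a' b] eb] := ex 0%N ((- a, v) : kos S^o i.+1 1).
  have e : dif y (- a : kos S^o i 1) + y i *: (v : S^o) = 0.
    by rewrite linearN /= ea addNr.
  exact: e.
have eb2 : - dif y (b : kos S^o i 1) = v := congr1 snd eb.
by apply/dif0_combs; exists (- b); rewrite linearN.
Qed.
End KoszulRegular.

Lemma combs_eq (A : comNzRingType) d (y y' : nat -> A) :
  (forall i, (i < d)%N -> y i = y' i) -> combs d y `<=` combs d y'.
Proof.
by move=> yy' a [c ->]; exists c; apply: eq_bigr => i _; rewrite yy'.
Qed.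

(** * Roots, Frobenius and descent to the base ring *)

Section PerfectClosureTheory.
Variables (p : nat) (R : comNzRingType) (chRp : p \in [pchar R]).
Local Notation PC := (perfect_closure chRp).
Local Notation root := (pc_root chRp).
Implicit Types (a b : R) (s t : PC).

Let p_pr : prime p. Proof. exact: pcharf_prime chRp. Qed.

Lemma rootD m a b : root m a + root m b = root m (a + b).
Proof.
rewrite [LHS]pc_addE; apply/pc_rootP; exists 0%N.
rewrite -exprDn_pchar; last by rewrite pnatX pnatE ?chRp.
by rewrite -exprM -expnD; congr (_ ^+ (p ^ _)); lia.
Qed.

Lemma rootM m a b : root m a * root m b = root m (a * b).
Proof.
rewrite [LHS]pc_mulE; apply/pc_rootP; exists 0%N.
by rewrite -exprMn -exprM -expnD; congr (_ ^+ (p ^ _)); lia.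
Qed.

Lemma root1 m : root m 1 = 1.
Proof. by apply/pc_rootP; exists 0%N; rewrite !expr1n. Qed.

Lemma root0 m : root m 0 = 0.
Proof.
by apply/pc_rootP; exists 0%N; rewrite !expr0n !expn_eq0 !eqn0Ngt prime_gt0.
Qed.

Lemma rootX m a k : root m a ^+ k = root m (a ^+ k).
Proof. by elim: k => [|k IH]; rewrite ?root1 // !exprS IH rootM. Qed.

Lemma root_frob m e a : root (m + e) a ^+ (p ^ e) = root m a.
Proof.
rewrite rootX; apply/pc_rootP; exists 0%N.
by rewrite -exprM -expnD; congr (_ ^+ (p ^ _)); lia.
Qed.

Lemma root0_inj : reduced R -> injective (root 0).
Proof.
move=> redR a b ab; apply/eqP; rewrite -subr_eq0.
have /pc_root0_eq0[k /redR->] // : root 0 (a - b) = 0.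
have := rootD 0 (a - b) b; rewrite subrK ab => /eqP.
by rewrite -subr_eq0 addrK => /eqP.
Qed.

Lemma pc_pchar : p \in [pchar PC].
Proof.
have natE k : k%:R = root 0 k%:R :> PC.
  by elim: k => [|k IH]; [rewrite root0 | rewrite !mulrS IH -(root1 0) rootD].
by rewrite inE p_pr natE (pcharf0 chRp) root0 eqxx.
Qed.

Lemma pc_frob_surj s e : exists t, t ^+ (p ^ e) = s.
Proof. by have [m [a ->]] := pc_rootW s; exists (root (m + e) a); apply: root_frob. Qed.

Lemma pc_frob_inj e : injective (fun s => s ^+ (p ^ e)).
Proof.
move=> s t st; apply/eqP; rewrite -subr_eq0; apply/eqP.
have : (s - t) ^+ (p ^ e) = 0.
  by rewrite exprDn_pchar ?exprNn_pchar ?st ?subrr // pnatX pnatE ?pc_pchar.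
have [m [a ->]] := pc_rootW (s - t); rewrite rootX => /pc_rootP[k].
rewrite expr0n expn_eq0 eqn0Ngt prime_gt0 //= -exprM -expnD => h.
rewrite -(root0 0); apply/pc_rootP; exists (e + k)%N.
by rewrite addnCA h expr0n expn_eq0 eqn0Ngt prime_gt0.
Qed.

Section RootsOfElements.
Variables (d : nat) (x : nat -> R).
Definition xroot e i : PC := root e (x i).
(** The exponent of x_i is (p - 1) / p^(e + 1) = 1 / p^e - 1 / p^(e + 1). *)
Definition zroot e i : PC := xroot e.+1 i ^+ p.-1.

Lemma xrootX e k i : xroot (e + k) i ^+ (p ^ k) = xroot e i.
Proof. exact: root_frob. Qed.

Lemma xroot_zroot e i : xroot e i = zroot e i * xroot e.+1 i.
Proof.
by rewrite /zroot -exprSr prednK ?prime_gt0 // -(xrootX e 1) expn1 addn1.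
Qed.

Lemma zroot_prod k i : \prod_(l < k) zroot l i = xroot k i ^+ (p ^ k).-1.
Proof.
elim: k => [|k IH]; first by rewrite big_ord0.
rewrite big_ord_recr /= IH -(xrootX k 1) addn1 -exprM -exprD; congr (_ ^+ _).
have /prednK e : (0 < p ^ k)%N by rewrite expn_gt0 prime_gt0.
by have := prime_gt0 p_pr; rewrite expn1 expnS -{2}e mulnS; lia.
Qed.

Lemma combs_root d' e k s :
  combs d' (xroot e) (s ^+ (p ^ k)) -> combs d' (xroot (e + k)) s.
Proof.
move=> [c ec]; have /choice[g hg] : forall i, exists t, t ^+ (p ^ k) = c i.
  by move=> i; apply: pc_frob_surj.
exists g; apply: (@pc_frob_inj k); rewrite ec (frob_sum pc_pchar).
by apply: eq_bigr => i _; rewrite exprMn hg xrootX.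
Qed.

Lemma combs_xroot0 a : combs d x a -> combs d (xroot 0) (root 0 a).
Proof.
move=> [c ->]; exists (fun i => root 0 (c i)).
by elim/big_rec2: _ => [|i t b _ <-]; rewrite ?root0 // rootM rootD.
Qed.

(** A power of Frobenius clears the denominators of the finitely many coefficients; the sum of their
    levels is a common bound. *)
Lemma combs_descend s : combs d (xroot 0) s -> exists k0, forall k, (k0 <= k)%N ->
  exists2 r, combs d (fun i => x i ^+ (p ^ k)) r & s ^+ (p ^ k) = root 0 r.
Proof.
move=> [c ->]; have /choice[c1 hc1] : forall i, exists ma : nat * R, c i = root ma.1 ma.2.
  by move=> i; have [m [a ->]] := pc_rootW (c i); exists (m, a).
exists (\sum_(i < d) (c1 i).1)%N => k le_k.
pose r i := (c1 i).2 ^+ (p ^ (k - (c1 i).1)).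
exists (\sum_(i < d) r i * x i ^+ (p ^ k)); first by exists r.
rewrite (frob_sum pc_pchar).
elim/big_rec2: _ => [|i t b _ ->]; first by rewrite root0.
rewrite -rootD; congr (_ + _).
rewrite exprMn /xroot rootX -rootM hc1; congr (_ * _).
have le_ck : ((c1 i).1 <= k)%N.
  by apply: leq_trans le_k; rewrite (bigD1 i) //= leq_addr.
have := root_frob 0 (c1 i).1 (c1 i).2; rewrite add0n => e.
by rewrite -{1}(subnKC le_ck) expnD exprM e rootX.
Qed.

(** Multiply the relation by s^(p - 1) to obtain the p-th power of [xroot e.+1 d' * s], then extract
    p-th roots. As p >= 2, [zroot e d'] is a multiple of [xroot e.+1 d']. *)
Lemma combs_colon e d' s : combs d' (xroot e) (xroot e d' * s) ->
  combs d' (xroot e.+1) (zroot e d' * s).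
Proof.
move=> h; have {}h : combs d' (xroot e.+1) (xroot e.+1 d' * s).
  rewrite -[e.+1]addn1; apply: combs_root.
  have sp : s ^+ (p ^ 1) = s * s ^+ p.-1 by rewrite expn1 -exprS prednK ?prime_gt0.
  rewrite exprMn xrootX sp mulrA.
  exact: idealMr (ideal_combs _ _) h.
have p1 := prime_gt1 p_pr; rewrite /zroot.
have -> : p.-1 = (p - 2).+1 by lia.
by rewrite exprSr -mulrA; apply: idealMl (ideal_combs _ _) h.
Qed.

(** The maximal ideal n, written as the increasing union of the ideals of roots. *)
Definition xrad s := exists e, combs d (xroot e) s.

Lemma combs_xroot_le e k : (e <= k)%N -> combs d (xroot e) `<=` combs d (xroot k).
Proof.
move=> /subnKC <-; elim: (k - e)%N => [|l IH]; first by rewrite addn0.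
rewrite addnS; apply: subset_trans IH _; apply: combs_sub => [|i lt_i].
  exact: ideal_combs.
by rewrite xroot_zroot; apply: idealMl (ideal_combs _ _) (mem_combs _ lt_i).
Qed.

Lemma ideal_xrad : is_ideal xrad.
Proof.
split=> [|s t [e es] [k kt]|s t [e et]].
- by exists 0%N; apply: ideal0 (ideal_combs _ _).
- exists (e + k)%N; apply: idealD (ideal_combs _ _) _ _.
    exact: combs_xroot_le (leq_addr _ _) _ es.
  exact: combs_xroot_le (leq_addl _ _) _ kt.
- by exists e; apply: idealMl (ideal_combs _ _) et.
Qed.

Lemma xrad_pow s : xrad s -> exists k, combs d (xroot 0) (s ^+ k).
Proof.
move=> [e /(combs_frob pc_pchar e) h]; exists (p ^ e)%N.
by apply: combs_eq h => i _; rewrite -[e in xroot e]add0n xrootX.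
Qed.

Section LocalParameters.
Variable m : set R.
Hypothesis noethR : noetherian R.
Hypothesis lm : is_local_ring m.
Hypothesis redR : reduced R.
Hypothesis dimR : has_prime_chain R d.
Hypothesis xm : forall i, (i < d)%N -> m (x i).
Hypothesis radx : forall a, m a -> exists k, combs d x (a ^+ k).

Let m_proper : is_proper_ideal m. Proof. by case: lm => -[]. Qed.
Let im : is_ideal m. Proof. by case: m_proper. Qed.

(** Let s be the p^e-th root of a. If a is in m, some a^k is in (x), and k < p^k gives a^(p^k) in
    (x); extracting p^(e + k)-th roots puts s into n. Otherwise a is a unit. *)
Lemma xrad_unit s : ~ xrad s -> exists t, t * s = 1.
Proof.
have [e [a ->]] := pc_rootW s => nxs.
have [b ba] : exists b, b * a = 1.
  apply: (local_unit lm) => ma; apply: nxs; have [k hk] := radx ma.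
  exists (e + k)%N; rewrite addnC -[k]add0n -addnA; apply: combs_root.
  rewrite addnC expnD exprM -[e]add0n root_frob rootX; apply: combs_xroot0.
  have /ltnW le_k : (k < p ^ k)%N by rewrite ltn_expl ?prime_gt1.
  by rewrite -(subnK le_k) exprD; apply: idealMl (ideal_combs _ _) hk.
by exists (root e b); rewrite rootM ba root1.
Qed.

Lemma combs_xroot0_proper : ~ combs d (xroot 0) 1.
Proof.
move=> /combs_descend[k /(_ k (leqnn _))[r xr]].
rewrite expr1n -(root1 0) => /(root0_inj redR) r1.
have [_] := m_proper; apply; rewrite r1; apply: combs_sub xr => // i lt_i.
have : (0 < p ^ k)%N by rewrite expn_gt0 prime_gt0.
case: (p ^ k)%N => // q _.
by rewrite exprS; apply: idealMr (xm lt_i).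
Qed.

Lemma xrad_proper : ~ xrad 1.
Proof. by move=> /xrad_pow[k]; rewrite expr1n; apply: combs_xroot0_proper. Qed.

(** The product telescopes to that of the x_i^(1 - 1/p^k). Frobenius moves the relation to R, where
    l0 absorbs the denominators of the coefficients; the monomial property is therefore applied to
    the powers x_i^(p^l0). *)
Lemma monomial_xroot k : ~ combs d (xroot 0) (\prod_(l < k) \prod_(i < d) zroot l i).
Proof.
rewrite exchange_big /= => /combs_descend[l0 /(_ (l0 + k)%N (leq_addr _ _))[r xr]].
pose y i := x i ^+ (p ^ l0).
have -> : (\prod_(i < d) \prod_(l < k) zroot l i) ^+ (p ^ (l0 + k)) =
    root 0 ((\prod_(i < d) y i) ^+ (p ^ k).-1).
  rewrite -!prodrXl; elim/big_rec2: _ => [|i b t _ ->]; first by rewrite root1.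
  rewrite -rootM; congr (_ * _); rewrite zroot_prod exprAC addnC expnD [X in X ^+ _]exprM.
  by rewrite -[k in xroot k]add0n xrootX /xroot !rootX.
move=> /(root0_inj redR) er; move: xr; rewrite -er.
have -> : (fun i => x i ^+ (p ^ (l0 + k))) = (fun i => y i ^+ (p ^ k)).
  by apply: funext => i; rewrite /y -exprM -expnD.
apply: (monomial_property chRp noethR lm dimR) => [i lt_i|a /radx[q hq]].
  rewrite /y; have : (0 < p ^ l0)%N by rewrite expn_gt0 prime_gt0.
  case: (p ^ l0)%N => // q _.
  by rewrite exprS; apply: idealMr (xm lt_i).
by exists (q * p ^ l0)%N; rewrite exprM; apply: (combs_frob chRp l0).
Qed.

Lemma combs_xroot0_colon i s : coherent PC -> (i < d)%N ->
  combs i (xroot 0) (xroot 0 i * s) -> combs i (xroot 0) s.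
Proof.
move=> cohPC; have nx e l : (l < d)%N -> xrad (xroot e l).
  by move=> lt_l; exists e; apply: mem_combs.
apply: (koszul_exact_regular cohPC ideal_xrad xrad_proper xrad_unit (nx 0%N)) => j a ca.
have h := koszul_acyclic cohPC ideal_xrad xrad_proper xrad_unit xroot_zroot
  combs_colon nx (fun _ => id) xrad_pow monomial_xroot.
by have /dies_const[b _ eb] := h j 0%N a ca; exists b.
Qed.

End LocalParameters.
End RootsOfElements.

Lemma seq_smul_combs (ys : seq R) (s : PC) :
  seq_smul ys s <-> combs (size ys) (xroot (nth 0 ys) 0) s.
Proof.
split=> [[c ->]|[c ->]].
  exists (fun i => if insub i is Some j then c j else 0).
  by apply: eq_bigr => i _; rewrite valK mulrC.
by exists (fun i => c i); apply: eq_bigr => i _; rewrite mulrC.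
Qed.

End PerfectClosureTheory.

Lemma ideal_gen_combs (A : comNzRingType) (ys : seq A) :
  ideal_gen ys = combs (size ys) (nth 0 ys).
Proof.
apply/predeqP => a; split=> [[c ->]|[c ->]].
  exists (fun i => if insub i is Some j then c j else 0).
  by apply: eq_bigr => i _; rewrite valK mulrC.
by exists (fun i => c i); apply: eq_bigr => i _; rewrite mulrC.
Qed.

Theorem theorem3p10 (p : nat) (R : comNzRingType) (m : set R)
    (chRp : p \in [pchar R])
    (R_noeth : noetherian R) (R_local : is_local_ring m) (R_red : reduced R)
    (R_quot : residue_ring_of_gorenstein_local R)
    (R_Fcoh : F_coherent chRp) :
  forall xs : seq R, system_of_parameters m xs ->
    regular_sequence (perfect_closure chRp) xs.
Proof.
move=> xs [[dimR _] _ radE]; have [_ cohPC] := R_Fcoh.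
have xm i : (i < size xs)%N -> m xs`_i.
  move=> lt_i; rewrite -radE; exists 1%N.
  by rewrite expr1 ideal_gen_combs; apply: mem_combs.
have radx a : m a -> exists k, combs (size xs) (nth 0 xs) (a ^+ k).
  by rewrite -radE -ideal_gen_combs.
split=> [i lt_i v|].
  have sz : size (take i xs) = i by rewrite size_take lt_i.
  have take_eq j : (j < i)%N -> xroot chRp (nth 0 (take i xs)) 0 j = xroot chRp (nth 0 xs) 0 j.
    by move=> lt_ji; rewrite /xroot nth_take.
  move=> /seq_smul_combs; rewrite sz => /(combs_eq take_eq) h.
  apply/seq_smul_combs; rewrite sz.
  apply: (combs_eq (fun j lt_j => esym (take_eq j lt_j))).
  exact: (combs_xroot0_colon R_noeth R_local R_red dimR xm radx cohPC lt_i).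
move=> full; apply: (combs_xroot0_proper R_local R_red xm (chRp := chRp)).
by apply/seq_smul_combs; rewrite full.
Qed.
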